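(* Let $m$ be a positive integer. If $X$ and $Y$ are infinite-dimensional Banach spaces over $\mathbb{K}$, $X$ has an unconditional Schauder basis and $\Pi_{FSt,1}(^mX;Y)=\mathcal{L}(^mX;Y)$, then $X$ is isomorphic to $\ell_1$ and $Y$ is isomorphic to a Hilbert space.
   Context: $\mathbb{K}=\mathbb{R}$ or $\mathbb{C}$. ''Isomorphic'' means linearly homeomorphic. $\mathcal{L}(^mX;Y)$ is the space of all continuous $m$-linear operators $X\times\cdots\times X\to Y$. For $1\le p<\infty$, $\Pi_{FSt,p}(^mX;Y)$ (factorable strongly $p$-summing $m$-linear operators) consists of those $T\in\mathcal{L}(^mX;Y)$ for which there is $C\ge0$ such that for all positive integers $m_1,m_2$, all $x_{k,j}^i\in X$ and all scalars $\lambda_j^i$ ($1\le k\le m$, $1\le j\le m_1$, $1\le i\le m_2$), $$\left(\sum_{j=1}^{m_1}\Big\|\sum_{i=1}^{m_2}\lambda_j^iT(x_{1,j}^i,\dots,x_{m,j}^i)\Big\|^p\right)^{1/p}\le C\sup_{\|\varphi\|\le1}\left(\sum_{j=1}^{m_1}\Big|\sum_{i=1}^{m_2}\lambda_j^i\varphi(x_{1,j}^i,\dots,x_{m,j}^i)\Big|^p\right)^{1/p},$$ the supremum being over all continuous $m$-linear forms $\varphi$ on $X\times\cdots\times X$ of norm at most $1$. *)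

(* Defs.v *)
From HB Require Import structures.
From mathcomp Require Import all_boot all_order all_algebra.
From mathcomp Require Import all_classical all_reals all_analysis.
From mathcomp Require Import complex.

Set Implicit Arguments.
Unset Strict Implicit.
Unset Printing Implicit Defensive.

Import Order.TTheory GRing.Theory Num.Theory.
Import numFieldNormedType.Exports.

Local Open Scope classical_set_scope.
Local Open Scope ring_scope.

Inductive scalar_kind := RealScalars | ComplexScalars.

Definition scalar_field (R : realType) (s : scalar_kind) : numFieldType :=
  match s with
  | RealScalars => R
  | ComplexScalars => R[i]
  end.

Definition scalar_conj (R : realType) (s : scalar_kind) :
    scalar_field R s -> scalar_field R s :=
  match s return scalar_field R s -> scalar_field R s with
  | RealScalars => id
  | ComplexScalars => @conjc R
  end.

(* In the library a norm over the field K takes its values in K; to_real and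
   of_real translate between R and the real elements of K, and rnorm is the
   norm as an element of R. *)
Definition to_real (R : realType) (s : scalar_kind) : scalar_field R s -> R :=
  match s return scalar_field R s -> R with
  | RealScalars => id
  | ComplexScalars => @complex.Re R
  end.

Definition of_real (R : realType) (s : scalar_kind) : R -> scalar_field R s :=
  match s return R -> scalar_field R s with
  | RealScalars => id
  | ComplexScalars => @real_complex R
  end.

Definition rnorm (R : realType) (s : scalar_kind)
  (V : normedModType (scalar_field R s)) (x : V) : R := to_real `|x|.

Section ScalarFacts.
Variables (R : realType) (s : scalar_kind).
Local Notation K := (scalar_field R s).

Lemma to_realD (a b : K) : to_real (a + b) = to_real a + to_real b.
Proof. by case: s a b => [//|] [? ?] [? ?]. Qed.

Lemma of_realK : cancel (@of_real R s) (@to_real R s).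
Proof. by case: s. Qed.

Lemma to_realK (V : normedModType K) (x : V) : of_real s (rnorm x) = `|x|.
Proof.
rewrite /rnorm; have: `|x| \is Num.real by exact: normr_real.
move: `|x|; case: s => //= -[a b] /complex_realP[c] [-> ->] //.
Qed.

Lemma of_realD (a b : R) : of_real s (a + b) = of_real s a + of_real s b.
Proof. by case: s => //=; rewrite rmorphD. Qed.

Lemma of_realM (a b : R) : of_real s (a * b) = of_real s a * of_real s b.
Proof. by case: s => //=; rewrite rmorphM. Qed.

Lemma of_real0 : of_real s (0 : R) = 0.
Proof. by case: s. Qed.

Lemma of_real_inj : injective (@of_real R s).
Proof. exact: can_inj of_realK. Qed.

Lemma ler_of_real (a b : R) : (of_real s a <= of_real s b) = (a <= b).
Proof. by case: s => //=; rewrite lecR. Qed.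

Variable V : normedModType K.

Lemma rnorm_ge0 (x : V) : 0 <= rnorm x.
Proof. by rewrite -ler_of_real of_real0 to_realK. Qed.

Lemma rnormD (x y : V) : rnorm (x + y) <= rnorm x + rnorm y.
Proof. by rewrite -ler_of_real of_realD !to_realK ler_normD. Qed.

Lemma rnormZ (a : K) (x : V) : rnorm (a *: x) = rnorm (a : K^o) * rnorm x.
Proof. by apply: of_real_inj; rewrite of_realM !to_realK normrZ. Qed.

Lemma rnorm0_eq0 (x : V) : rnorm x = 0 -> x = 0.
Proof. by move=> x0; apply/normr0_eq0; rewrite -to_realK x0 of_real0. Qed.

Lemma rnorm0 : rnorm (0 : V) = 0.
Proof. by apply: of_real_inj; rewrite to_realK normr0 of_real0. Qed.

End ScalarFacts.

Section Ell1.
Variables (R : realType) (s : scalar_kind).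
Local Notation K := (scalar_field R s).

Definition summable_seq : {pred nat -> K^o} :=
  fun a => `[< cvgn (series (fun n => rnorm (a n))) >].

Lemma summable_seq_submod : submod_closed summable_seq.
Proof.
split=> [|c a b /asboolP ca /asboolP cb]; apply/asboolP.
  rewrite (_ : (fun _ => _) = fun=> 0); last by apply/funext => n; exact: rnorm0.
  apply/cvg_ex; exists 0; rewrite (_ : series _ = fun=> 0); first exact: cvg_cst.
  by apply/funext => n; rewrite /series /= big1.
apply: (@series_le_cvg _ _
    (fun n => rnorm (c : K^o) * rnorm (a n) + rnorm (b n))).
- by move=> n; exact: rnorm_ge0.
- by move=> n; rewrite addr_ge0 ?mulr_ge0 ?rnorm_ge0.
- by move=> n; rewrite (le_trans (rnormD _ _))// -rnormZ.
- have cca : cvgn (series (rnorm (c : K^o) *: (fun n => rnorm (a n)))).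
    exact: is_cvg_seriesZ.
  exact: (is_cvg_seriesD cca cb).
Qed.

HB.instance Definition _ :=
  GRing.isSubmodClosed.Build K (nat -> K^o) summable_seq summable_seq_submod.

Record l1 := L1 { l1_val :> nat -> K^o; _ : l1_val \in summable_seq }.

HB.instance Definition _ := [isSub for l1_val].
HB.instance Definition _ := [Choice of l1 by <:].
HB.instance Definition _ := [SubChoice_isSubLmodule of l1 by <:].

Definition l1_norm (a : l1) : K :=
  of_real s (limn (series (fun n => rnorm (a n)))).

Lemma l1_cvg (a : l1) : cvgn (series (fun n => rnorm (a n))).
Proof. by case: a => a /= /asboolP. Qed.
Arguments l1_cvg : clear implicits.

Lemma l1_normD (a b : l1) : l1_norm (a + b) <= l1_norm a + l1_norm b.
Proof.
rewrite -of_realD ler_of_real -(lim_seriesD (l1_cvg a) (l1_cvg b)).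
apply: lim_series_le; first exact: l1_cvg.
  exact: (is_cvg_seriesD (l1_cvg a) (l1_cvg b)).
by move=> n; exact: rnormD.
Qed.

Lemma l1_normZ (c : K) (a : l1) : l1_norm (c *: a) = `|c| * l1_norm a.
Proof.
rewrite /l1_norm -(to_realK (c : K^o)) -of_realM; congr of_real.
rewrite -[RHS](lim_seriesZ _ (l1_cvg a)).
by congr (limn (series _)); apply/funext => n; exact: rnormZ.
Qed.

Lemma l1_norm0_eq0 (a : l1) : l1_norm a = 0 -> a = 0.
Proof.
rewrite -(of_real0 R s) => /of_real_inj a0; apply/val_inj/funext => n.
apply/rnorm0_eq0/eqP; rewrite eq_le rnorm_ge0 andbT -[leRHS]a0.
have nd : nondecreasing_seq (series (fun k => rnorm (a k))).
  by apply/nondecreasing_seqP => k; rewrite seriesSr lerDl rnorm_ge0.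
rewrite (le_trans _ (nondecreasing_cvgn_le nd (l1_cvg a) n.+1))//.
by rewrite seriesSr lerDr sumr_ge0// => k _; exact: rnorm_ge0.
Qed.

HB.instance Definition _ :=
  Lmodule_isNormed.Build K l1 l1_normD l1_normZ l1_norm0_eq0.

End Ell1.

Section BanachSpaces.
Variables (R : realType) (s : scalar_kind).
Local Notation K := (scalar_field R s).

Definition isomorphic (V W : normedModType K) : Prop :=
  exists (f : {linear V -> W}) (g : {linear W -> V}),
    [/\ cancel f g, cancel g f, continuous f & continuous g].

Definition is_hilbert (H : completeNormedModType K) : Prop :=
  exists ip : {dot H for @scalar_conj R s}, forall x : H, ip x x = `|x| ^+ 2.

Definition infinite_dimensional (V : lmodType K) : Prop :=
  ~ exists (n : nat) (v : 'I_n -> V),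
      forall x, exists a : 'I_n -> K, x = \sum_(i < n) a i *: v i.

Definition schauder_basis (V : normedModType K) (e : nat -> V) : Prop :=
  forall x : V, exists! a : nat -> K, series (fun n => a n *: e n) @ \oo --> x.

Definition unconditionally_convergent (V : normedModType K) (u : nat -> V) :
    Prop :=
  forall sigma : nat -> nat, bijective sigma -> cvgn (series (u \o sigma)).

Definition unconditional_basis (V : normedModType K) (e : nat -> V) : Prop :=
  schauder_basis e /\
  forall a : nat -> K, cvgn (series (fun n => a n *: e n)) ->
    unconditionally_convergent (fun n => a n *: e n).

End BanachSpaces.

Section MultilinearOperators.
Variables (R : realType) (s : scalar_kind) (m : nat).
Local Notation K := (scalar_field R s).

Definition multilinear (V W : lmodType K) (T : ('I_m -> V) -> W) : Prop :=
  forall (k : 'I_m) (x : 'I_m -> V),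
    linear (fun v : V => T (fun l => if l == k then v else x l)).

(* {ptws 'I_m -> V} is the m-fold product of V with the product topology. *)
Definition continuous_multilinear (V W : normedModType K) :
    set ({ptws 'I_m -> V} -> W) :=
  [set T : {ptws 'I_m -> V} -> W | multilinear T /\ continuous T].

(* The supremum of a set of reals that is not bounded above is 0 in the
   library; for a continuous multilinear T the set below is bounded. *)
Definition multilinear_norm (V W : normedModType K)
    (T : {ptws 'I_m -> V} -> W) : R :=
  sup [set rnorm (T x) | x in [set x | forall k, rnorm (x k) <= 1]].

Definition unit_forms (V : normedModType K) :
    set ({ptws 'I_m -> V} -> K^o) :=
  [set phi : {ptws 'I_m -> V} -> K^o |
    continuous_multilinear phi /\ multilinear_norm phi <= 1].

Definition weak_sum (V : normedModType K) (p : R) (m1 m2 : nat)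
    (lambda : 'I_m1 -> 'I_m2 -> K) (x : 'I_m1 -> 'I_m2 -> {ptws 'I_m -> V})
    (W : normedModType K) (T : {ptws 'I_m -> V} -> W) : R :=
  (\sum_(j < m1) rnorm (\sum_(i < m2) lambda j i *: T (x j i)) `^ p) `^ p^-1.

(* The supremum is finite: the sums are bounded uniformly in phi. *)
Definition factorable_strongly_summing (p : R) (V W : normedModType K) :
    set ({ptws 'I_m -> V} -> W) :=
  [set T : {ptws 'I_m -> V} -> W | continuous_multilinear T /\
    exists2 C : R, 0 <= C &
      forall m1 m2 : nat, (0 < m1)%N -> (0 < m2)%N ->
      forall (lambda : 'I_m1 -> 'I_m2 -> K)
             (x : 'I_m1 -> 'I_m2 -> {ptws 'I_m -> V}),
        weak_sum p lambda x T <=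
        C * sup [set weak_sum p lambda x phi | phi in @unit_forms V]].

End MultilinearOperators.

(* Main.v *)
Require Import Defs.
From HB Require Import structures.
From mathcomp Require Import all_boot all_order all_algebra perm.
From mathcomp Require Import all_classical all_reals all_analysis.
From mathcomp Require Import complex ring lra.

Set Implicit Arguments.
Unset Strict Implicit.
Unset Printing Implicit Defensive.

Import Order.TTheory GRing.Theory Num.Theory.
Import numFieldNormedType.Exports.

Local Open Scope classical_set_scope.
Local Open Scope ring_scope.

(** Why the theorem is true.

    If $u : X \to Y$ is a bounded operator and $\psi$ is a coordinate functional
    of the basis of $X$, the multilinear operator
    $T(x_1, \dots, x_m) = \psi(x_2) \cdots \psi(x_m) u(x_1)$ is factorable strongly
    $1$-summing only if $u$ is absolutely summing ([factorable_linear_summing]).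
    So the statement is about spaces all of whose operators $X \to Y$ are
    absolutely summing, a theorem of Lindenstrauss and Pelczynski. By a gliding
    hump, the summing constant is then at most $k \|u\|$ for some constant $k$
    ([uniform_summing]).

    The space $X$. The basis has a finite unconditional constant
    ([unconditional_constant]), because the supremum of the norms of all finite
    subsums of an expansion is a countably subadditive seminorm, hence bounded
    ([countably_subadditive_bounded]). Since $Y$ is infinite-dimensional, it
    contains for every $n$ vectors $y_1, \dots, y_n$ with $\|y_i\| \ge 1/4$ and
    $\|\sum_i a_i y_i\|^2 \le 2 \sum_i |a_i|^2$ ([dvoretzky_rogers]). They come from a
    contraction of a Euclidean space of dimension $2n$ into $Y$ whose determinant is
    almost maximal. Let $b_i$ be the coordinates of $x$ in the normalized basis, and
    let $N$ be the best constant in $\sum_{i \le n} |b_i| \le N \|x\|$. The operator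
    $x \mapsto \sum_{i \le n} b_i y_i$ has norm at most a multiple of $\sqrt N$, and its
    summing constant shows that $\sum_{i \le n} |b_i|$ is bounded by a multiple of
    $\sqrt N \|x\|$. Thus $N \le L \sqrt N$ with $L$ independent of $n$, so that $N$ is
    bounded ([l1sum_bounded]) and the coordinates define an isomorphism of $X$ with
    $\ell_1$ ([isomorphic_l1]).

    The space $Y$. The operators from $\ell_1$ to $Y$ are also $2$-summing, which
    implies that $\sum_j \|\sum_i a_{ji} y_i\|^2 \le M \sum_i \|y_i\|^2$ for every contraction
    matrix $a$ ([l2_contraction_inequality]). By Zorn's lemma there is a minimal
    $2$-homogeneous function $q \le M \|\cdot\|^2$ with
    $\sum_j \|\sum_i a_{ji} y_i\|^2 \le \sum_i q(y_i)$ for all such $a$. This is a Hahn-Banach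
    argument: minimality makes some of these inequalities almost tight at any given
    vector, and a rotation of two such instances gives the parallelogram identity
    for $q$ ([equivalent_quadratic_form]). By the Jordan-von Neumann theorem, $\sqrt q$
    is a Hilbert norm on $Y$, and it is equivalent to the given one. *)

(** * Scalars and real-valued norms *)

Section Scalars.
Variables (R : realType) (s : scalar_kind).
Local Notation K := (scalar_field R s).

(** The modulus of a scalar, as a real number. *)
Definition sabs (a : K) : R := rnorm (a : K^o).

Lemma sabsE (a : K) : of_real s (sabs a) = `|a|.
Proof. exact: (to_realK (a : K^o)). Qed.

Lemma of_realN (a : R) : of_real s (- a) = - of_real s a.
Proof. by case: s => //=; rewrite rmorphN. Qed.

Lemma of_realB (a b : R) : of_real s (a - b) = of_real s a - of_real s b.
Proof. by rewrite of_realD of_realN. Qed.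

Lemma of_real1 : of_real s (1 : R) = 1.
Proof. by case: s. Qed.

Lemma of_realV (a : R) : of_real s a^-1 = (of_real s a)^-1.
Proof. by case: s => //=; rewrite fmorphV. Qed.

Lemma of_real_eq0 (a : R) : (of_real s a == 0) = (a == 0).
Proof. by rewrite -(of_real0 R s) (inj_eq (@of_real_inj R s)). Qed.

Lemma ltr_of_real (a b : R) : (of_real s a < of_real s b) = (a < b).
Proof. by rewrite !lt_def ler_of_real (inj_eq (@of_real_inj R s)). Qed.

Lemma sabs_ge0 (a : K) : 0 <= sabs a.
Proof. exact: rnorm_ge0. Qed.

Lemma sabsM (a b : K) : sabs (a * b) = sabs a * sabs b.
Proof. exact: (rnormZ a (b : K^o)). Qed.

Lemma sabs_of_real (r : R) : sabs (of_real s r) = `|r|.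
Proof.
apply: (@of_real_inj R s); rewrite sabsE.
by case: s => //=; rewrite normc_def /= expr0n addr0 sqrtr_sqr.
Qed.

Lemma sabs0 : sabs 0 = 0.
Proof. exact: rnorm0. Qed.

Lemma sabs1 : sabs 1 = 1.
Proof. by rewrite -of_real1 sabs_of_real normr1. Qed.

Lemma sabs_prod (I : Type) (r : seq I) (P : pred I) (F : I -> K) :
  sabs (\prod_(i <- r | P i) F i) = \prod_(i <- r | P i) sabs (F i).
Proof. by apply: (big_morph sabs); [exact: sabsM | exact: sabs1]. Qed.

Lemma sabsX (a : K) n : sabs (a ^+ n) = sabs a ^+ n.
Proof.
by elim: n => [|n IH]; rewrite ?expr0 ?sabs1 // !exprS sabsM IH.
Qed.

Lemma sabsN (a : K) : sabs (- a) = sabs a.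
Proof. by apply: (@of_real_inj R s); rewrite !sabsE normrN. Qed.

Lemma sabsD (a b : K) : sabs (a + b) <= sabs a + sabs b.
Proof. exact: rnormD. Qed.

Lemma sabs0_eq0 (a : K) : sabs a = 0 -> a = 0.
Proof. exact: rnorm0_eq0. Qed.

Lemma sabsV (a : K) : sabs a^-1 = (sabs a)^-1.
Proof.
by apply: (@of_real_inj R s); rewrite of_realV !sabsE normfV.
Qed.

Lemma sabs_gt0 (a : K) : a != 0 -> 0 < sabs a.
Proof.
move=> a0; rewrite lt_def sabs_ge0 andbT; apply: contraNneq a0.
by move/sabs0_eq0 ->.
Qed.

Lemma to_real_le_sabs (a : K) : `|to_real a| <= sabs a.
Proof.
rewrite -(ler_of_real s) sabsE; move: a; case: s => //= a.
exact: normc_ge_Re.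
Qed.

Lemma to_realN (a : K) : to_real (- a) = - to_real a.
Proof. by case: s a => [//|] [? ?]. Qed.

Lemma to_real0 : to_real (0 : K) = 0.
Proof. by case: s. Qed.

Lemma to_real_sum (I : Type) (r : seq I) (P : pred I) (F : I -> K) :
  to_real (\sum_(i <- r | P i) F i) = \sum_(i <- r | P i) to_real (F i).
Proof.
by apply: (big_morph (@to_real R s)); [exact: to_realD | exact: to_real0].
Qed.

(** The imaginary unit, or $0$ over the reals. *)
Definition iunit : K :=
  match s return scalar_field R s with
  | RealScalars => 0
  | ComplexScalars => 'i%C
  end.

Lemma sabs_iunit : sabs iunit <= 1.
Proof.
rewrite -(ler_of_real s) sabsE of_real1 /iunit; case: s => /=.
  by rewrite normr0.
by rewrite normc_def /= expr0n expr1n add0r sqrtr1.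
Qed.

Lemma scalar_decomp (a : K) : exists u v : R,
  a = of_real s u + iunit * of_real s v /\ sabs a ^+ 2 = u ^+ 2 + v ^+ 2.
Proof.
have [u [v [e1 e2]]] : exists u v : R,
  a = of_real s u + iunit * of_real s v /\ `|a| ^+ 2 = of_real s (u ^+ 2 + v ^+ 2).
  rewrite /iunit; move: a; case: s => [a|[u v]] /=.
    by exists a, 0; rewrite mul0r addr0 expr0n addr0 real_normK ?num_real.
  exists u, v; split; first by rewrite complexiE; simpc.
  by rewrite normc_def -rmorphXn /= sqr_sqrtr // addr_ge0 // sqr_ge0.
exists u, v; split => //; apply: (@of_real_inj R s).
by rewrite -e2 -sabsE expr2 of_realM -expr2.
Qed.

Lemma scalar_re_im (a : K) :
  a = of_real s (to_real a) - iunit * of_real s (to_real (iunit * a)).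
Proof.
rewrite /iunit; move: a; case: s => [a|[u v]] /=.
  by rewrite mul0r subr0.
by rewrite mul0r mul1r sub0r rmorphN /= mulrN opprK complexiE; simpc.
Qed.

Lemma sabs_le_to_real (a : K) :
  sabs a <= `|to_real a| + `|to_real (iunit * a)|.
Proof.
rewrite {1}[a]scalar_re_im (le_trans (sabsD _ _)) // sabs_of_real lerD2l sabsN.
by rewrite sabsM sabs_of_real ler_piMl // sabs_iunit.
Qed.

Lemma sabs_parallelogram (a b : K) :
  sabs (a + b) ^+ 2 + sabs (a - b) ^+ 2 = 2 * (sabs a ^+ 2 + sabs b ^+ 2).
Proof.
have E (c : K) : of_real s (sabs c ^+ 2) = `|c| ^+ 2.
  by rewrite expr2 of_realM sabsE -expr2.
apply: (@of_real_inj R s).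
rewrite mulr_natl mulr2n !of_realD !E.
move: a b {E}; case: s => [a b|[a1 a2] [b1 b2]] /=.
  by rewrite !real_normK ?num_real //; ring.
rewrite !normc_def -!rmorphXn /= !sqr_sqrtr ?addr_ge0 ?sqr_ge0 //.
by rewrite -!rmorphD /=; congr (_%:C)%C; ring.
Qed.

(** The sum of the moduli is controlled by the moduli of the partial sums over
    all subfamilies: split the real parts according to their signs. *)
Lemma sum_sabs_le (I : Type) (r : seq I) (t : I -> K) (B : R) :
  (forall P : pred I, sabs (\sum_(i <- r | P i) t i) <= B) ->
  \sum_(i <- r) sabs (t i) <= 4 * B.
Proof.
move=> HB.
have real_part (v : I -> K) : (forall P : pred I, sabs (\sum_(i <- r | P i) v i) <= B) ->
    \sum_(i <- r) `|to_real (v i)| <= 2 * B.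
  move=> Hv; rewrite (bigID (fun i => 0 <= to_real (v i))) /=.
  rewrite (_ : 2 * B = B + B); last by ring.
  apply: lerD.
    rewrite (eq_bigr (fun i => to_real (v i))); last by move=> i; exact: ger0_norm.
    rewrite -to_real_sum (le_trans (ler_norm _)) //.
    by rewrite (le_trans (to_real_le_sabs _)).
  rewrite (eq_bigr (fun i => - to_real (v i))); last first.
    by move=> i; rewrite -ltNge => /ltr0_norm.
  rewrite sumrN -to_real_sum (le_trans (ler_norm _)) // normrN.
  by rewrite (le_trans (to_real_le_sabs _)).
rewrite (le_trans (ler_sum _ (fun i _ => sabs_le_to_real (t i)))) //.
rewrite big_split /= (_ : 4 * B = 2 * B + 2 * B); last by ring.
apply: lerD; apply: real_part => // P.
rewrite -mulr_sumr sabsM (le_trans _ (HB P)) // ler_piMl ?sabs_ge0 //.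
exact: sabs_iunit.
Qed.

Section RealNorm.
Variable V : normedModType K.
Implicit Types x y : V.

Lemma rnormN x : rnorm (- x) = rnorm x.
Proof. by apply: (@of_real_inj R s); rewrite !to_realK normrN. Qed.

Lemma rnormB_sym x y : rnorm (x - y) = rnorm (y - x).
Proof. by rewrite -rnormN opprB. Qed.

Lemma rnormZs (a : K) x : rnorm (a *: x) = sabs a * rnorm x.
Proof. exact: rnormZ. Qed.

Lemma rnormZr (r : R) x : rnorm (of_real s r *: x) = `|r| * rnorm x.
Proof. by rewrite rnormZs sabs_of_real. Qed.

Lemma rnormB x y : rnorm (x - y) <= rnorm x + rnorm y.
Proof. by rewrite -[rnorm y]rnormN rnormD. Qed.

Lemma rnorm_dist x y z : rnorm (x - z) <= rnorm (x - y) + rnorm (y - z).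
Proof. by rewrite (le_trans _ (rnormD _ _)) // addrA subrK. Qed.

Lemma rnorm_sum (I : Type) (r : seq I) (P : pred I) (F : I -> V) :
  rnorm (\sum_(i <- r | P i) F i) <= \sum_(i <- r | P i) rnorm (F i).
Proof.
elim/big_rec2: _ => [|i x y _ le]; first by rewrite rnorm0.
by rewrite (le_trans (rnormD _ _)) // lerD2l.
Qed.

Lemma rnorm_gt0 x : x != 0 -> 0 < rnorm x.
Proof.
move=> x0; rewrite lt_def rnorm_ge0 andbT; apply: contraNneq x0.
by move/rnorm0_eq0 ->.
Qed.

Lemma scale_half x : of_real s 2^-1 *: (x + x) = x.
Proof.
rewrite scalerDr -scalerDl -of_realD (_ : 2^-1 + 2^-1 = 1); last by field.
by rewrite of_real1 scale1r.
Qed.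

Lemma rnorm_double x : rnorm (x + x) = 2 * rnorm x.
Proof.
by rewrite -[in RHS](scale_half x) rnormZr ger0_norm ?invr_ge0 // mulVKf ?pnatr_eq0.
Qed.

Lemma rnorm_eq0_small x : (forall e : R, 0 < e -> rnorm x <= e) -> x = 0.
Proof.
move=> H; apply: rnorm0_eq0; apply/eqP; rewrite eq_le rnorm_ge0 andbT.
by apply/ler_addgt0Pr => e e0; rewrite add0r H.
Qed.

End RealNorm.

End Scalars.

(** * Sequential convergence for the real-valued norm *)

Section NormConvergence.
Variables (R : realType) (s : scalar_kind).
Local Notation K := (scalar_field R s).

Lemma pos_of_real (e : K) : 0 < e -> exists2 r : R, 0 < r & e = of_real s r.
Proof.
move=> e0; exists (sabs e); first by apply: sabs_gt0; rewrite gt_eqF.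
by rewrite sabsE gtr0_norm.
Qed.

Lemma rnorm_lt (V : normedModType K) (x : V) (r : R) :
  (`|x| < of_real s r) = (rnorm x < r).
Proof. by rewrite -to_realK ltr_of_real. Qed.

Section Norm.
Variable V : normedModType K.
Implicit Types (u v : nat -> V) (l : V).

(** Convergence of a sequence for the real-valued norm. *)
Definition rcvg u l := forall e : R, 0 < e ->
  exists N, forall n, (N <= n)%N -> rnorm (u n - l) <= e.

Lemma rcvgP u l : rcvg u l <-> u @ \oo --> l.
Proof.
split=> [H|/cvgrPdist_lt H].
  apply/cvgrPdist_lt => e /pos_of_real[r r0 ->].
  have [N HN] := H (r / 2) (divr_gt0 r0 (ltr0n _ 2)).
  exists N => // n /= /HN; rewrite rnorm_lt rnormB_sym => /le_lt_trans; apply.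
  by rewrite ltr_pdivrMr // ltr_pMr // ltr1n.
move=> e e0; have [|N _ HN] := H (of_real s e).
  by rewrite -(of_real0 R s) ltr_of_real.
exists N => n /HN; rewrite /= rnorm_lt rnormB_sym; exact: ltW.
Qed.

Lemma rcvg_unique u l l' : rcvg u l -> rcvg u l' -> l = l'.
Proof.
move=> H H'; apply/eqP; rewrite -subr_eq0; apply/eqP.
apply: rnorm_eq0_small => e e0.
have [N HN] := H _ (divr_gt0 e0 (ltr0n _ 2)).
have [N' HN'] := H' _ (divr_gt0 e0 (ltr0n _ 2)).
have h := HN _ (leq_maxl N N'); have h' := HN' _ (leq_maxr N N').
apply: (le_trans (rnorm_dist _ (u (maxn N N')) _)).
by rewrite (rnormB_sym l) [leRHS]splitr lerD.
Qed.

Lemma rcvg_cst l : rcvg (fun=> l) l.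
Proof. by move=> e e0; exists 0%N => n _; rewrite subrr rnorm0 ltW. Qed.

Lemma rcvgD u v l l' : rcvg u l -> rcvg v l' -> rcvg (fun n => u n + v n) (l + l').
Proof.
move=> H H' e e0.
have [N HN] := H _ (divr_gt0 e0 (ltr0n _ 2)).
have [N' HN'] := H' _ (divr_gt0 e0 (ltr0n _ 2)).
exists (maxn N N') => n; rewrite geq_max => /andP[h h'].
rewrite opprD addrACA [leRHS]splitr (le_trans (rnormD _ _)) // lerD //.
  exact: HN.
exact: HN'.
Qed.

Lemma rcvg_ext u v l : u =1 v -> rcvg u l -> rcvg v l.
Proof. by move=> /funext ->. Qed.

Lemma rcvg_shift k u l : rcvg u l -> rcvg (fun n => u (n + k)%N) l.
Proof.
move=> H e /H[N HN]; exists N => n Nn; apply: HN.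
by rewrite (leq_trans Nn) // leq_addr.
Qed.

Lemma rcvg_norm_le u l (B : R) : rcvg u l -> (forall n, rnorm (u n) <= B) ->
  rnorm l <= B.
Proof.
move=> H HB; apply/ler_addgt0Pr => e /H[N HN].
rewrite -[l](subrK (u N)) (le_trans (rnormD _ _)) // addrC lerD //.
by rewrite rnormB_sym HN.
Qed.

End Norm.

(** Convergence passes through any map with a Lipschitz bound. *)
Lemma rcvg_lip (V W : normedModType K) (f : V -> W) (C : R) (u : nat -> V) (l : V) :
  (forall x y, rnorm (f x - f y) <= C * rnorm (x - y)) ->
  rcvg u l -> rcvg (f \o u) (f l).
Proof.
move=> Hf H e e0.
have C0 : 0 < `|C| + 1 by rewrite ltr_wpDl.
have [N HN] := H _ (divr_gt0 e0 C0).
exists N => n /HN h /=; apply: (le_trans (Hf _ _)).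
apply: (@le_trans _ _ ((`|C| + 1) * rnorm (u n - l))).
  by rewrite ler_wpM2r ?rnorm_ge0 // (le_trans (ler_norm _)) // lerDl.
by rewrite -ler_pdivlMl // mulrC.
Qed.

Lemma rcvgZ (V : normedModType K) (a : K) (u : nat -> V) (l : V) :
  rcvg u l -> rcvg (fun n => a *: u n) (a *: l).
Proof.
apply: (@rcvg_lip V V ( *:%R a) (sabs a)) => x y.
by rewrite -scalerBr rnormZs.
Qed.


Lemma rcvg_sum (V : normedModType K) (I : Type) (r : seq I)
    (u : I -> nat -> V) (l : I -> V) :
  (forall i, rcvg (u i) (l i)) ->
  rcvg (fun n => \sum_(i <- r) u i n) (\sum_(i <- r) l i).
Proof.
move=> H; elim: r => [|i r IH].
  apply: (@rcvg_ext _ (fun=> 0)); first by move=> n; rewrite big_nil.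
  by rewrite big_nil; exact: rcvg_cst.
apply: (@rcvg_ext _ (fun n => u i n + \sum_(j <- r) u j n)).
  by move=> n; rewrite big_cons.
by rewrite big_cons; apply: rcvgD.
Qed.

(** Sequential completeness, for the real-valued norm. *)
Definition seq_complete (V : normedModType K) := forall u : nat -> V,
  (forall e : R, 0 < e -> exists N, forall n, (N <= n)%N ->
    rnorm (u n - u N) <= e) ->
  exists l, rcvg u l.

Lemma rcomplete (V : completeNormedModType K) : seq_complete V.
Proof.
move=> u H; suff /cvg_ex[l /rcvgP ul] : cvg (u @ \oo) by exists l.
apply: cauchy_cvg; apply: cauchy_exP => e /pos_of_real[r r0 ->].
have [N HN] := H (r / 2) (divr_gt0 r0 (ltr0n _ 2)).
exists (u N); exists N => // n /= /HN; rewrite -ball_normE /ball_ /= rnorm_lt.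
rewrite rnormB_sym => /le_lt_trans; apply.
by rewrite ltr_pdivrMr // ltr_pMr // ltr1n.
Qed.

Section Telescope.
Variables (V : normedModType K) (cV : seq_complete V).

(** A sequence whose increments are dominated by a summable series converges,
    with the tail of the series as an error bound. *)
Lemma rcomplete_tele (w : nat -> V) (c : nat -> R) (B : R) :
  (forall n, rnorm (w n.+1 - w n) <= c n) ->
  (forall n, \sum_(k < n) c k <= B) ->
  exists2 l, rcvg w l & forall n, rnorm (l - w n) <= B - \sum_(k < n) c k.
Proof.
move=> Hw HB.
have tele n p : rnorm (w (n + p)%N - w n) <= \sum_(k < n + p) c k - \sum_(k < n) c k.
  elim: p => [|p IH]; first by rewrite addn0 !subrr rnorm0.
  rewrite addnS big_ord_recr /= addrAC (le_trans (rnorm_dist _ (w (n + p)%N) _)) //.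
  by rewrite addrC lerD.
have c0 n : 0 <= c n by rewrite (le_trans _ (Hw n)) // rnorm_ge0.
have [l Hl] : exists l, rcvg w l.
  apply: cV => e e0.
  have hs : has_sup [set \sum_(k < n) c k | n in [set: nat]].
    by split; [exists (\sum_(k < 0) c k), 0%N | exists B => _ [n _ <-]].
  have [_ [N _ <-] HN] := sup_adherent e0 hs.
  exists N => n Nn; rewrite -(subnKC Nn) (le_trans (tele _ _)) //.
  rewrite lerBlDr; apply: ltW; rewrite -ltrBlDl; apply: le_lt_trans HN.
  by rewrite lerD2r; apply: sup_upper_bound => //; exists (N + (n - N))%N.
exists l => // n.
apply: (@rcvg_norm_le _ (fun p => w (p + n)%N - w n)).
  by apply: rcvgD; [exact: rcvg_shift | exact: rcvg_cst].
move=> p; rewrite addnC (le_trans (tele _ _)) // lerD2r; exact: HB.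
Qed.

End Telescope.

End NormConvergence.

Section ScalarComplete.
Variables (R : realType) (s : scalar_kind).
Local Notation K := (scalar_field R s).

Lemma scalar_complete : seq_complete (K^o : normedModType K).
Proof.
move=> u H.
have part (f : K -> R) : (forall a b, `|f a - f b| <= sabs (a - b)) ->
    exists l : R, forall e : R, 0 < e -> exists N, forall n, (N <= n)%N ->
      `|f (u n) - l| <= e.
  move=> Hf; have := @rcomplete R RealScalars (R : completeNormedModType R).
  move=> /(_ (f \o u))[|l Hl]; last by exists l.
  move=> e /H[N HN]; exists N => n /HN h; exact: le_trans (Hf _ _) h.
have [|a Ha] := part (@to_real R s).
  by move=> x y; rewrite -to_realN -to_realD to_real_le_sabs.
have [|b Hb] := part (fun x => to_real (iunit R s * x)).
  move=> x y; rewrite -to_realN -to_realD -mulrN -mulrDr.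
  rewrite (le_trans (to_real_le_sabs _)) // sabsM ler_piMl ?sabs_ge0 //.
  exact: sabs_iunit.
exists (of_real s a - iunit R s * of_real s b) => e e0.
have [N HN] := Ha _ (divr_gt0 e0 (ltr0n _ 2)).
have [M HM] := Hb _ (divr_gt0 e0 (ltr0n _ 2)).
exists (maxn N M) => n; rewrite geq_max => /andP[/HN h1 /HM h2].
rewrite [leRHS]splitr {1}[u n]scalar_re_im opprD addrACA -opprD -mulrBr -!of_realB.
rewrite (le_trans (sabsD _ _)) // sabs_of_real lerD // sabsN sabsM sabs_of_real.
by rewrite (le_trans _ h2) // ler_piMl // sabs_iunit.
Qed.

End ScalarComplete.

(** * Unconditional convergence *)

(** If the natural numbers are cut into consecutive finite intervals, there is
    a permutation that moves, within every interval, a prescribed subset to the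
    front. *)
Lemma block_rearrangement (N : nat -> nat) (F : nat -> pred nat) :
  N 0%N = 0%N -> (forall k, (N k < N k.+1)%N) ->
  exists2 sigma : nat -> nat, bijective sigma &
    forall k, let b := [seq i <- index_iota (N k) (N k.+1) | F k i] in
      forall j, (j < size b)%N -> sigma (N k + j)%N = nth 0%N b j.
Proof.
move=> N0 NS.
have Nmono k k' : (k <= k')%N -> (N k <= N k')%N.
  apply: (homo_leq (r := leq)) => //; first exact: leq_trans.
  by move=> i; exact: ltnW.
have [kk Hkk] : {kk : nat -> nat & forall n, (N (kk n) <= n < N (kk n).+1)%N}.
  apply: (@choice _ _ (fun n k => (N k <= n < N k.+1)%N)) => n.
  elim: n => [|n [k /andP[h1 h2]]]; first by exists 0%N; rewrite N0 leqnn -[X in (X < _)%N]N0 NS.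
  have [h|h] := ltnP n.+1 (N k.+1); first by exists k; rewrite h ltnW.
  by exists k.+1; rewrite h (leq_ltn_trans h2 (NS _)).
have kkE k n : (N k <= n < N k.+1)%N -> kk n = k.
  move=> /andP[h1 h2]; have /andP[h3 h4] := Hkk n.
  apply/eqP; rewrite eqn_leq; apply/andP; split; rewrite leqNgt.
    by apply/negP => /Nmono h; move: (leq_trans h2 (leq_trans h h3)); rewrite ltnn.
  by apply/negP => /Nmono h; move: (leq_trans h4 (leq_trans h h1)); rewrite ltnn.
pose b k := [seq i <- index_iota (N k) (N k.+1) | F k i].
pose t k := b k ++ [seq i <- index_iota (N k) (N k.+1) | ~~ F k i].
have tP k : perm_eq (t k) (index_iota (N k) (N k.+1)) by apply/permPl/perm_filterC.
have tsz k : size (t k) = (N k.+1 - N k)%N by rewrite (perm_size (tP k)) size_iota.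
have tu k : uniq (t k) by rewrite (perm_uniq (tP k)) iota_uniq.
have tm k i : (i \in t k) = (N k <= i < N k.+1)%N.
  by rewrite (perm_mem (tP k)) mem_index_iota.
pose sigma n := nth 0%N (t (kk n)) (n - N (kk n)).
pose tau m := (N (kk m) + index m (t (kk m)))%N.
have lt_sz n : (n - N (kk n) < size (t (kk n)))%N.
  by rewrite tsz ltn_sub2r //; have /andP[h1 h2] := Hkk n => //; exact: leq_ltn_trans h2.
exists sigma.
  exists tau => n.
    have : sigma n \in t (kk n) by rewrite mem_nth.
    rewrite tm => /kkE e; rewrite /tau e /sigma index_uniq //.
    by rewrite subnKC //; case/andP: (Hkk n).
  have mt : n \in t (kk n) by rewrite tm Hkk.
  have e : kk (tau n) = kk n.
    apply: kkE; rewrite /tau leq_addr /= -ltn_subRL -tsz index_mem //.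
  by rewrite /sigma e /tau addKn nth_index.
move=> k /= j jb.
have jt : (j < size (t k))%N by rewrite size_cat ltn_addr.
have e : kk (N k + j)%N = k.
  by apply: kkE; rewrite leq_addr /= -ltn_subRL -tsz.
by rewrite /sigma e addKn nth_cat jb.
Qed.

Section Unconditional.
Variables (R : realType) (s : scalar_kind).
Local Notation K := (scalar_field R s).
Variable V : normedModType K.

(** Small finite sums far away: otherwise a rearrangement puts sums bounded
    below by a constant next to each other. *)
Lemma unconditional_cauchy (u : nat -> V) : unconditionally_convergent u ->
  forall e : R, 0 < e -> exists N, forall n (P : pred nat),
    rnorm (\sum_(N <= i < n | P i) u i) <= e.
Proof.
move=> Hu e e0; apply: contrapT => /forallNP H.
have {}H N : exists nP : nat * pred nat,
    e < rnorm (\sum_(N <= i < nP.1 | nP.2 i) u i).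
  have /existsNP[n /existsNP[P /negP]] := H N; rewrite -ltNge => h.
  by exists (n, P).
have [g Hg] := choice H.
(* consecutive intervals, each of them containing a finite sum larger than $e$ *)
pose fix N k := if k is k'.+1 then (g (N k')).1 else 0%N.
have NS k : (N k < N k.+1)%N.
  have := Hg (N k); rewrite /= ltnNge; apply: contraTN => h.
  by rewrite big_geq // rnorm0 -leNgt ltW.
have [sigma sb Hs] := @block_rearrangement N (fun k => (g (N k)).2) erefl NS.
have /cvg_ex[l /rcvgP Hl] := Hu sigma sb.
have [M HM] := Hl (e / 2) (divr_gt0 e0 (ltr0n _ 2)).
have Nge k : (k <= N k)%N.
  by elim: k => [//|k IH]; rewrite (leq_ltn_trans IH (NS k)).
pose b := [seq i <- index_iota (N M) (N M.+1) | (g (N M)).2 i].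
(* compare the partial sums at both ends of the front part of a late block *)
have hM := Hg (N M); rewrite -big_filter -[X in index_iota _ X]/(N M.+1) -/b in hM.
have e1 : \sum_(i <- b) u i = series (u \o sigma) (N M + size b)%N - series (u \o sigma) (N M).
  rewrite /series /= (big_cat_nat (leq0n _) (leq_addr (size b) (N M))) /=.
  rewrite [X in X - _]addrC addrK -{1}[N M]add0n big_addn addKn (big_nth 0%N).
  rewrite !big_mkord; apply: eq_bigr => i _.
  by rewrite /= addnC Hs.
move: hM; rewrite e1 ltNge => /negP; apply.
have h1 := HM (N M + size b)%N (leq_trans (Nge M) (leq_addr _ _)).
have h2 := HM (N M) (Nge M).
by rewrite (le_trans (rnorm_dist _ l _)) // [leRHS]splitr lerD // rnormB_sym.
Qed.

(** The sums over all finite sets of indices are bounded. *)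
Lemma unconditional_bounded (u : nat -> V) : unconditionally_convergent u ->
  exists M : R, forall n (P : pred nat), rnorm (\sum_(i < n | P i) u i) <= M.
Proof.
move=> /unconditional_cauchy/(_ 1 ltr01)[N HN].
exists (\sum_(i < N) rnorm (u i) + 1) => n P.
have finite m : (m <= N)%N ->
    rnorm (\sum_(i < m | P i) u i) <= \sum_(i < N) rnorm (u i).
  move=> mN; rewrite (le_trans (rnorm_sum _ _ _)) //.
  rewrite big_mkcond /= (big_ord_widen N (fun i => if P i then rnorm (u i) else 0)) //.
  rewrite [leRHS](bigID (fun i : 'I_N => (i < m)%N)) /= -[leLHS]addr0 lerD //.
    by apply: ler_sum => i _; case: ifP => // _; exact: rnorm_ge0.
  by apply: sumr_ge0 => i _; exact: rnorm_ge0.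
have [nN|Nn] := leqP n N; first by rewrite (le_trans (finite _ nN)) // lerDl.
rewrite -(big_mkord P u) (big_cat_nat (leq0n _) (ltnW Nn)) /=.
by rewrite (le_trans (rnormD _ _)) // lerD // big_mkord finite.
Qed.

End Unconditional.

(** * Countably subadditive seminorms are bounded *)

Section CountablySubadditive.
Variables (R : realType) (s : scalar_kind).
Local Notation K := (scalar_field R s).
Variables (V : completeNormedModType K) (p : V -> R).
Hypothesis pD : forall x y, p (x + y) <= p x + p y.
Hypothesis pZ : forall (r : R) x, p (of_real s r *: x) = `|r| * p x.
Hypothesis pS : forall (a : nat -> V) (B : R) x,
  rcvg (fun n => \sum_(k < n) a k) x ->
  (forall n, \sum_(k < n) p (a k) <= B) -> p x <= B.

(** The category argument: the sets $\{p \le n\}$ cover the space, so that one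
    of them is dense in some ball. *)
Lemma sublevel_dense_in_ball : exists (n : nat) (x0 : V) (r : R), 0 < r /\
  forall y (e : R), 0 < e -> rnorm (y - x0) < r ->
    exists z, rnorm (z - y) <= e /\ p z <= n%:R.
Proof.
apply: contrapT => H.
have {}H (t : nat * (V * R)) : exists yr : V * R, 0 < t.2.2 ->
    [/\ 0 < yr.2, rnorm (yr.1 - t.2.1) < t.2.2 &
       forall z, rnorm (z - yr.1) <= yr.2 -> t.1%:R < p z].
  case: t => n [x0 r] /=; have [r0|r0] := ltP 0 r; last by exists (0, 0).
  apply: contrapT => H'; apply: H; exists n, x0, r; split => // y e e0 yr.
  apply: contrapT => H''; apply: H'; exists (y, e) => _; split => // z zy.
  by rewrite ltNge; apply/negP => pz; apply: H''; exists z.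
have [g Hg] := choice H.
(* nested balls: the ball number $n + 1$ avoids the set $\{p \le n\}$ *)
pose fix st n : V * R := if n is m.+1 then
    let yr := g (m, st m) in
    (yr.1, Num.min yr.2 ((st m).2 - rnorm (yr.1 - (st m).1)))
  else (0, 1).
have st0 n : 0 < (st n).2.
  elim: n => [|n IH] //=; have [h1 h2 _] := Hg (n, st n) IH.
  by rewrite lt_min h1 subr_gt0.
have stS n : rnorm ((st n.+1).1 - (st n).1) <= (st n).2 - (st n.+1).2.
  by rewrite /= lerBrDr addrC -lerBrDr ge_min lexx orbT.
have tele n : \sum_(k < n) ((st k).2 - (st k.+1).2) = 1 - (st n).2.
  elim: n => [|n IH]; first by rewrite big_ord0 subrr.
  by rewrite big_ord_recr /= IH addrA subrK.
have [n|l _ Hl] := rcomplete_tele (rcomplete (V := V)) (w := fun n => (st n).1) (B := 1) stS.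
  by rewrite tele gerBl ltW.
have pl n : n%:R < p l.
  have [h1 h2] := Hg (n, st n) (st0 n); apply.
  have := Hl n.+1; rewrite tele opprB addrCA subrr addr0 => /le_trans; apply.
  by rewrite /= ge_min lexx.
by have := pl (Num.truncn (p l)).+1; rewrite ltNge ltW // truncnS_gt.
Qed.

Lemma half_pow_small (C e : R) : 0 < e -> exists N, forall n, (N <= n)%N ->
  2^-1 ^+ n * C <= e.
Proof.
move=> e0; pose N := (Num.truncn (`|C| / e)).+1; exists N => n Nn.
rewrite (le_trans (ler_norm _)) // normrM normrX ger0_norm ?invr_ge0 //.
rewrite exprVn mulrC ler_pdivrMr ?exprn_gt0 //.
rewrite mulrC -ler_pdivrMr // (le_trans (ltW (truncnS_gt _))) // -natrX ler_nat.
by rewrite (leq_trans Nn) // ltnW // ltn_expl.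
Qed.

(** A countably subadditive seminorm on a Banach space is bounded
    (Zabreiko's lemma). *)
Theorem countably_subadditive_bounded :
  exists2 C : R, 0 <= C & forall x, p x <= C * rnorm x.
Proof.
have [n [x0 [r [r0 H]]]] := sublevel_dense_in_ball.
have pN x : p (- x) = p x.
  by rewrite -[p x]mul1r -normr1 -normrN -pZ of_realN of_real1 scaleN1r.
(* the dense ball can be centred at the origin, by symmetry and convexity *)
have dense0 x (e : R) : 0 < e -> rnorm x < r -> exists z, rnorm (z - x) <= e /\ p z <= n%:R.
  move=> e0 xr.
  have [|z1 [d1 p1]] := H (x0 + x) e e0; first by rewrite addrAC subrr add0r.
  have [|z2 [d2 p2]] := H (x0 - x) e e0.
    by rewrite addrAC subrr add0r rnormN.
  exists (of_real s 2^-1 *: (z1 - z2)); split.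
    have -> : of_real s 2^-1 *: (z1 - z2) - x =
        of_real s 2^-1 *: ((z1 - (x0 + x)) - (z2 - (x0 - x))).
      have -> : z1 - (x0 + x) - (z2 - (x0 - x)) = (z1 - z2) - (x + x).
        rewrite [- (z2 - _)]opprD addrACA -opprD; congr (_ - _).
        by rewrite opprB (addrC x0 x) addrACA subrr addr0.
      by rewrite [RHS]scalerBr scale_half.
    rewrite rnormZr ger0_norm ?invr_ge0 // ler_pdivrMl // mulr_natl mulr2n.
    by rewrite (le_trans (rnormB _ _)) // lerD.
  rewrite pZ ger0_norm ?invr_ge0 // ler_pdivrMl // mulr_natl mulr2n.
  by rewrite (le_trans (pD _ _)) // pN lerD.
have p0 : p 0 = 0 by rewrite -(scaler0 _ (of_real s 0)) pZ normr0 mul0r.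
have pge0 x : 0 <= p x.
  have := pD x (- x); rewrite subrr p0 pN -mulr2n -mulr_natl.
  by rewrite pmulr_rge0.
have r2 : 0 < r / 2 by rewrite divr_gt0.
have bounded x : rnorm x <= r / 2 -> p x <= 2 * n%:R.
  have [a Ha] : {a : V -> V & forall y, rnorm y <= r / 2 ->
      rnorm (a y - y) <= r / 2 / 2 /\ p (a y) <= n%:R}.
    apply: (@choice _ _ (fun y z => rnorm y <= r / 2 ->
      rnorm (z - y) <= r / 2 / 2 /\ p z <= n%:R)) => y.
    have [yr|_] := leP (rnorm y) (r / 2); last by exists 0.
    have [||z Hz] := dense0 y (r / 2 / 2); [by rewrite divr_gt0 | | by exists z].
    by rewrite (le_lt_trans yr) // ltr_pdivrMr // ltr_pMr // ltr1n.
  (* $x = \sum_k 2^{-k} a(x_k)$, where $x_{k+1} = 2 (x_k - a(x_k))$ is the rescaled error *)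
  move=> xr; pose xs k := iter k (fun y => of_real s 2 *: (y - a y)) x.
  have xsr k : rnorm (xs k) <= r / 2.
    elim: k => [//|k /Ha[+ _]]; rewrite /= rnormZr ger0_norm // rnormB_sym.
    by rewrite ler_pdivlMr // mulrC.
  have partial m : \sum_(k < m) of_real s (2^-1 ^+ k) *: a (xs k) =
      x - of_real s (2^-1 ^+ m) *: xs m.
    elim: m => [|m IH]; first by rewrite big_ord0 expr0 of_real1 scale1r subrr.
    rewrite big_ord_recr /= IH scalerA -of_realM exprSr -mulrA mulVf ?pnatr_eq0 //.
    by rewrite mulr1 scalerBr opprB addrA addrAC.
  have sums m : \sum_(k < m) p (of_real s (2^-1 ^+ k) *: a (xs k)) <= 2 * n%:R.
    apply: (@le_trans _ _ (\sum_(k < m) 2^-1 ^+ k * n%:R)).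
      apply: ler_sum => k _; rewrite pZ ger0_norm ?exprn_ge0 ?invr_ge0 //.
      by rewrite ler_wpM2l ?exprn_ge0 ?invr_ge0 //; case: (Ha _ (xsr k)).
    rewrite -mulr_suml ler_wpM2r //.
    suff -> : \sum_(k < m) 2^-1 ^+ k = 2 - 2 * 2^-1 ^+ m :> R.
      by rewrite gerBl mulr_ge0 // exprn_ge0 // invr_ge0.
    elim: m => [|m IH]; first by rewrite big_ord0 expr0; ring.
    by rewrite big_ord_recr /= IH exprS; field.
  apply: (pS (a := fun k => of_real s (2^-1 ^+ k) *: a (xs k))) sums => e e0.
  have [N HN] := half_pow_small (r / 2) e0.
  exists N => m /HN h; rewrite partial addrC addKr rnormN rnormZr.
  rewrite ger0_norm ?exprn_ge0 ?invr_ge0 // (le_trans _ h) //.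
  by rewrite ler_wpM2l ?exprn_ge0 ?invr_ge0.
move: (r / 2) r2 bounded => rho rho0 bounded {r r0 H dense0}.
exists (2 * n%:R / rho); first by rewrite divr_ge0 ?mulr_ge0 // ltW.
move=> x; have [->|x_neq0] := eqVneq x 0; first by rewrite p0 rnorm0 mulr0.
have nx := rnorm_gt0 x_neq0; have q0 : 0 < rho / rnorm x by rewrite divr_gt0.
have := bounded (of_real s (rho / rnorm x) *: x).
rewrite rnormZr pZ (ger0_norm (ltW q0)) divfK ?gt_eqF // => /(_ (lexx _)).
rewrite -ler_pdivlMl // invf_div => /le_trans; apply.
by rewrite mulrC !mulrA [leLHS]mulrAC.
Qed.

End CountablySubadditive.

(** * Unconditional bases have a finite unconditional constant *)

Lemma seriesE (M : zmodType) (u : nat -> M) : series u = fun n => \sum_(i < n) u i.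
Proof. by apply/funext => n; rewrite /series /= big_mkord. Qed.

Section Basis.
Variables (R : realType) (s : scalar_kind).
Local Notation K := (scalar_field R s).
Variables (V : completeNormedModType K) (e : nat -> V).
Hypothesis He : unconditional_basis e.

(** The coordinates of a vector in the basis. *)
Definition bcoef (x : V) : nat -> K := projT1 (cid (proj1 He x)).

Lemma bcoefP x : rcvg (fun n => \sum_(i < n) bcoef x i *: e i) x.
Proof.
by rewrite /bcoef; case: cid => a /= [/rcvgP]; rewrite seriesE.
Qed.

Lemma bcoef_unique (x : V) (a : nat -> K) :
  rcvg (fun n => \sum_(i < n) a i *: e i) x -> bcoef x = a.
Proof.
rewrite /bcoef; case: cid => b /= [_ Hb] H; apply: Hb; apply/rcvgP.
by rewrite seriesE.
Qed.

Lemma bcoefZD (c : K) x y i : bcoef (c *: x + y) i = c * bcoef x i + bcoef y i.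
Proof.
suff -> : bcoef (c *: x + y) = fun i => c * bcoef x i + bcoef y i by [].
apply: bcoef_unique; apply: (@rcvg_ext _ _ _ (fun n => c *: (\sum_(i < n) bcoef x i *: e i)
    + \sum_(i < n) bcoef y i *: e i)).
  move=> n; rewrite scaler_sumr -big_split; apply: eq_bigr => j _.
  by rewrite scalerDl scalerA.
by apply: rcvgD; [apply: rcvgZ; exact: bcoefP | exact: bcoefP].
Qed.

Lemma bcoef0 i : bcoef 0 i = 0.
Proof.
have := bcoefZD 1 0 0 i; rewrite scale1r addr0 mul1r => /eqP.
by rewrite -subr_eq0 opprD addrA subrr sub0r oppr_eq0 => /eqP.
Qed.

Lemma bcoefZ (c : K) x i : bcoef (c *: x) i = c * bcoef x i.
Proof. by rewrite -[c *: x]addr0 bcoefZD bcoef0 addr0. Qed.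

Lemma bcoef_basis k i : bcoef (e k) i = (i == k)%:R.
Proof.
suff -> : bcoef (e k) = fun i => (i == k)%:R by [].
apply: bcoef_unique => r r0; exists k.+1 => n kn.
rewrite (bigD1 (Ordinal kn)) //= eqxx scale1r big1 ?addr0 ?subrr ?rnorm0 ?ltW //.
by move=> j jk; rewrite (_ : (j == k :> nat) = false) ?scale0r //; apply/negbTE.
Qed.

Lemma basis_neq0 k : e k != 0.
Proof.
apply/eqP => ek; have := bcoef_basis k k; rewrite ek bcoef0 eqxx => /esym/eqP.
by rewrite oner_eq0.
Qed.

(** The part of the expansion of [x] carried by the indices in [P] below [n]. *)
Definition psum (n : nat) (P : pred nat) (x : V) : V :=
  \sum_(i < n | P i) bcoef x i *: e i.

Lemma psumZD n P (c : K) x y : psum n P (c *: x + y) = c *: psum n P x + psum n P y.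
Proof.
rewrite /psum scaler_sumr -big_split; apply: eq_bigr => j _.
by rewrite bcoefZD scalerDl scalerA.
Qed.

Lemma psumD n P x y : psum n P (x + y) = psum n P x + psum n P y.
Proof. by rewrite -[x in LHS]scale1r psumZD scale1r. Qed.

Lemma psum0 n P : psum n P 0 = 0.
Proof. by rewrite /psum big1 // => i _; rewrite bcoef0 scale0r. Qed.

Lemma psumZ n P (c : K) x : psum n P (c *: x) = c *: psum n P x.
Proof. by rewrite -[c *: x]addr0 psumZD psum0 addr0. Qed.

Lemma psum_sum n P (I : Type) (r : seq I) (x : I -> V) :
  psum n P (\sum_(i <- r) x i) = \sum_(i <- r) psum n P (x i).
Proof. by apply: (big_morph (psum n P)); [exact: psumD | exact: psum0]. Qed.

(** The unconditional norm: the supremum of the norms of the finite partial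
    sums over all sets of indices. *)
Definition unorm (x : V) : R :=
  sup [set r | exists n P, rnorm (psum n P x) = r].

Lemma unorm_has_sup x :
  has_sup [set r | exists n P, rnorm (psum n P x) = r].
Proof.
split; first by exists (rnorm (psum 0 xpredT x)), 0%N, xpredT.
have : cvgn (series (fun n => bcoef x n *: e n)).
  by apply/cvg_ex; exists x; apply/rcvgP; rewrite seriesE; exact: bcoefP.
move=> /(proj2 He)/unconditional_bounded[M HM].
by exists M => _ [n [P <-]]; exact: HM.
Qed.

Lemma unorm_ub n P x : rnorm (psum n P x) <= unorm x.
Proof. by apply: (sup_upper_bound (unorm_has_sup x)); exists n, P. Qed.

Lemma unorm_le x (B : R) : (forall n P, rnorm (psum n P x) <= B) -> unorm x <= B.
Proof.
move=> H; apply: ge_sup; first by case: (unorm_has_sup x).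
by move=> _ [n [P <-]].
Qed.

Lemma unorm_bcoef x i : sabs (bcoef x i) * rnorm (e i) <= unorm x.
Proof.
rewrite -rnormZs (le_trans _ (unorm_ub i.+1 (pred1 i) x)) // /psum.
rewrite (bigD1 ord_max) //= ?eqxx // big1 ?addr0 //.
by move=> j /andP[/eqP ji]; rewrite -val_eqE /= ji eqxx.
Qed.

Lemma unorm_ge0 x : 0 <= unorm x.
Proof. by rewrite (le_trans _ (unorm_ub 0 xpredT x)) // rnorm_ge0. Qed.

Lemma unormD x y : unorm (x + y) <= unorm x + unorm y.
Proof.
apply: unorm_le => n P; rewrite psumD (le_trans (rnormD _ _)) //.
by rewrite lerD // unorm_ub.
Qed.

Lemma unormZ (r : R) x : unorm (of_real s r *: x) = `|r| * unorm x.
Proof.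
have le (t : R) y : unorm (of_real s t *: y) <= `|t| * unorm y.
  apply: unorm_le => n P; rewrite psumZ rnormZr.
  by rewrite ler_wpM2l // unorm_ub.
apply/eqP; rewrite eq_le le /=; have [->|r0] := eqVneq r 0.
  by rewrite normr0 mul0r unorm_ge0.
have := le r^-1 (of_real s r *: x).
rewrite scalerA -of_realM mulVf // of_real1 scale1r normfV => h.
by rewrite -ler_pdivlMl // normr_gt0.
Qed.

(** Completeness for the unconditional norm: if the series $\sum_j a_j$
    converges and $\sum_j$ [unorm] $a_j \le B$, the expansion of the sum is
    obtained coordinatewise. *)
Lemma unorm_sigma_subadditive (a : nat -> V) (B : R) x :
  rcvg (fun n => \sum_(k < n) a k) x ->
  (forall n, \sum_(k < n) unorm (a k) <= B) -> unorm x <= B.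
Proof.
move=> ax HB.
have coord i : exists b : K, rcvg (V := K^o) (fun n => \sum_(k < n) bcoef (a k) i) b.
  have ei := rnorm_gt0 (basis_neq0 i).
  have [||b Hb _] := rcomplete_tele (@scalar_complete R s)
      (w := fun n => \sum_(k < n) bcoef (a k) i) (c := fun n => unorm (a n) / rnorm (e i))
      (B := B / rnorm (e i)).
  - move=> n; rewrite big_ord_recr /= addrAC subrr add0r ler_pdivlMr //.
    exact: unorm_bcoef.
  - by move=> n; rewrite -mulr_suml ler_pM2r ?invr_gt0.
  by exists b.
have [b Hb] := choice coord.
pose T n (P : pred nat) := \sum_(i < n | P i) b i *: e i.
have TP n P : rcvg (fun m => \sum_(k < m) psum n P (a k)) (T n P).
  apply: (@rcvg_ext _ _ _ (fun m => \sum_(i <- [seq i : 'I_n <- index_enum 'I_n | P i])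
      (\sum_(k < m) bcoef (a k) i) *: e i)).
    move=> m; rewrite big_filter exchange_big; apply: eq_bigr => i _ /=.
    by rewrite scaler_suml.
  rewrite /T -big_filter; apply: rcvg_sum => i.
  apply: (@rcvg_lip _ _ (K^o : normedModType K) V ( *:%R ^~ (e i)) (rnorm (e i)) _ _ _ (Hb i)).
  by move=> c d; rewrite -scalerBl rnormZs mulrC.
have partial_le n P m : rnorm (\sum_(k < m) psum n P (a k)) <= B.
  rewrite (le_trans (rnorm_sum _ _ _)) // (le_trans _ (HB m)) //.
  by apply: ler_sum => k _; exact: unorm_ub.
have T_le n P : rnorm (T n P) <= B by apply: rcvg_norm_le (TP n P) _.
suff xb : bcoef x = b by apply: unorm_le => n P; rewrite /psum xb; exact: T_le.
pose S m := \sum_(k < m) unorm (a k).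
have Smono m p : (m <= p)%N -> S m <= S p.
  move=> mp; rewrite /S -(subnKC mp) big_split_ord /= lerDl.
  by apply: sumr_ge0 => k _; exact: unorm_ge0.
have hs : has_sup [set S m | m in [set: nat]].
  by split; [exists (S 0%N), 0%N | exists B => _ [m _ <-]; exact: HB].
have tail (r : R) : 0 < r -> exists m0, forall m, (m0 <= m)%N -> forall n P,
    rnorm (T n P - \sum_(k < m) psum n P (a k)) <= r.
  move=> r0; have [_ [m0 _ <-] Hm0] := sup_adherent r0 hs.
  exists m0 => m m0m n P.
  have [||l Hl Hl'] := rcomplete_tele (rcomplete (V := V))
      (w := fun m => \sum_(k < m) psum n P (a k)) (c := fun k => unorm (a k))
      (B := sup [set S m | m in [set: nat]]).
  - by move=> k; rewrite big_ord_recr /= addrAC subrr add0r unorm_ub.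
  - by move=> k; apply: sup_upper_bound => //; exists k.
  rewrite (rcvg_unique (TP n P) Hl) (le_trans (Hl' m)) //.
  rewrite lerBlDr -lerBlDl (le_trans (ltW Hm0)) //; exact: Smono.
apply: bcoef_unique => r r0.
have r3 : 0 < r / 3 by rewrite divr_gt0.
have [m0 Hm0] := tail _ r3; have [m1 Hm1] := ax _ r3.
pose m := maxn m0 m1; have [N HN] := bcoefP (\sum_(k < m) a k) r3.
exists N => n /HN h1.
have h2 := Hm1 m (leq_maxr _ _); have h0 := Hm0 m (leq_maxl _ _) n xpredT.
rewrite -psum_sum in h0.
have -> : r = r / 3 + (r / 3 + r / 3) by field.
rewrite (le_trans (rnorm_dist _ (psum n xpredT (\sum_(k < m) a k)) _)) //.
rewrite lerD // (le_trans (rnorm_dist _ (\sum_(k < m) a k) _)) //.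
by rewrite lerD.
Qed.

(** An unconditional basis of a Banach space has a finite unconditional
    constant. *)
Theorem unconditional_constant :
  exists2 C : R, 0 <= C & forall x, unorm x <= C * rnorm x.
Proof.
apply: countably_subadditive_bounded.
- exact: unormD.
- exact: unormZ.
- exact: unorm_sigma_subadditive.
Qed.

End Basis.

(** * Absolutely summing operators *)

Section Summing.
Variables (R : realType) (s : scalar_kind).
Local Notation K := (scalar_field R s).

(** [bounded_linear u B]: the map [u] is linear of norm at most [B]. *)
Definition bounded_linear (V W : normedModType K) (u : V -> W) (B : R) :=
  linear u /\ forall x, rnorm (u x) <= B * rnorm x.

(** The finite family [xs] has weak $\ell_1$-norm at most [W]. *)
Definition weak_l1_le (V : normedModType K) (xs : seq V) (W : R) :=
  forall phi : V -> K^o, bounded_linear phi 1 ->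
    \sum_(x <- xs) sabs (phi x) <= W.

(** The map [u] is absolutely summing with constant at most [C]. *)
Definition summing (V Y : normedModType K) (u : V -> Y) (C : R) :=
  forall xs W, weak_l1_le xs W -> \sum_(x <- xs) rnorm (u x) <= C * W.

Section BoundedLinear.
Variables (V W : normedModType K).
Implicit Types u v : V -> W.

Lemma linear0_fun u : linear u -> u 0 = 0.
Proof.
move=> lu; have := lu 1 0 0; rewrite !scale1r addr0 => /eqP.
by rewrite -subr_eq0 opprD addrA subrr sub0r oppr_eq0 => /eqP.
Qed.

Lemma linearD_fun u x y : linear u -> u (x + y) = u x + u y.
Proof. by move=> lu; have := lu 1 x y; rewrite !scale1r. Qed.

Lemma linearZ_fun u c x : linear u -> u (c *: x) = c *: u x.
Proof. by move=> lu; have := lu c x 0; rewrite (linear0_fun lu) !addr0. Qed.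

Lemma linear_sum_fun u (I : Type) (r : seq I) (P : pred I) (F : I -> V) :
  linear u -> u (\sum_(i <- r | P i) F i) = \sum_(i <- r | P i) u (F i).
Proof.
move=> lu; apply: (big_morph u); last exact: linear0_fun.
by move=> x y; exact: linearD_fun.
Qed.

Lemma bounded_linear0 : bounded_linear (fun _ : V => 0 : W) 0.
Proof.
by split=> [c x y|x]; [rewrite scaler0 addr0 | rewrite rnorm0 mul0r].
Qed.

Lemma bounded_linearZ u B (c : K) : bounded_linear u B ->
  bounded_linear (fun x => c *: u x) (sabs c * B).
Proof.
move=> [lu Hu]; split=> [a x y|x].
  by rewrite lu scalerDr !scalerA mulrC.
by rewrite rnormZs -mulrA ler_wpM2l ?sabs_ge0.
Qed.

Lemma bounded_linearW u B C : B <= C -> bounded_linear u B -> bounded_linear u C.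
Proof.
move=> BC [lu Hu]; split => // x; rewrite (le_trans (Hu x)) //.
by rewrite ler_wpM2r ?rnorm_ge0.
Qed.

End BoundedLinear.

Lemma weak_l1_ge0 (V : normedModType K) (xs : seq V) W : weak_l1_le xs W -> 0 <= W.
Proof.
move=> /(_ (fun=> 0)) H; rewrite (le_trans _ (H _)) //.
  by apply: sumr_ge0 => x _; exact: sabs_ge0.
exact: bounded_linearW ler01 (bounded_linear0 _ _).
Qed.

Lemma weak_l1Z (V : normedModType K) (xs : seq V) W (c : K) : weak_l1_le xs W ->
  weak_l1_le [seq c *: x | x <- xs] (sabs c * W).
Proof.
move=> H phi Hphi; rewrite big_map (eq_bigr (fun x => sabs c * sabs (phi x))).
  by rewrite -mulr_sumr ler_wpM2l ?sabs_ge0 ?H.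
by move=> x _; rewrite (linearZ_fun _ _ (proj1 Hphi)) -sabsM.
Qed.

(** Uniform boundedness for summing norms, by a gliding hump: if every bounded
    operator is absolutely summing, the summing constant is controlled by the
    operator norm. Operators $u_n$ that violate this more and more are added up
    as $\sum_n \pm 3^{-n} u_n$, where the signs keep the $n$-th summing norm from
    cancelling. *)
Section UniformSumming.
Variables (V : normedModType K) (Y : completeNormedModType K).
Hypothesis all_summing : forall (u : V -> Y) B, bounded_linear u B ->
  exists C, summing u C.

Local Notation total xs u := (\sum_(x <- xs) rnorm (u x)).

(** Failure of the bound [k], normalized. *)
Lemma summing_large_sum (k : R) : 0 <= k ->
  (exists (u : V -> Y) B, [/\ 0 <= B, bounded_linear u B & ~ summing u (k * B)]) ->
  exists (xs : seq V) (u : V -> Y),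
    [/\ weak_l1_le xs 1, bounded_linear u 1 & k < total xs u].
Proof.
move=> k0 [u [B [B0 Hu]]].
move=> /existsNP[xs /existsNP[W /not_implyP[HW /negP]]]; rewrite -ltNge => lt.
have W0 := weak_l1_ge0 HW.
have {}W0 : 0 < W.
  rewrite lt_def W0 andbT; apply: contraTneq lt => W00.
  have [C HC] := all_summing Hu; rewrite W00 -leNgt mulr0.
  by have := HC xs W HW; rewrite W00 mulr0.
have {}B0 : 0 < B.
  rewrite lt_def B0 andbT; apply: contraTneq lt => B00.
  rewrite B00 mulr0 mul0r -leNgt big1_seq // => x _; apply/eqP.
  by rewrite eq_le rnorm_ge0 andbT (le_trans (proj2 Hu x)) // B00 mul0r.
exists [seq of_real s W^-1 *: x | x <- xs], (fun x => of_real s B^-1 *: u x).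
split.
- have := weak_l1Z (of_real s W^-1) HW.
  by rewrite sabs_of_real ger0_norm ?invr_ge0 ?ltW // mulVf ?gt_eqF.
- have := bounded_linearZ (of_real s B^-1) Hu.
  by rewrite sabs_of_real ger0_norm ?invr_ge0 ?ltW // mulVf ?gt_eqF.
rewrite big_map (eq_bigr (fun x => (B^-1 * W^-1) * rnorm (u x))).
  by rewrite -mulr_sumr -invfM ltr_pdivlMl ?mulr_gt0 // mulrC mulrA.
move=> x _; rewrite (linearZ_fun _ _ (proj1 Hu)) !rnormZr.
by rewrite !ger0_norm ?invr_ge0 ?ltW // mulrA.
Qed.

Lemma total_bounded xs (u : V -> Y) B : bounded_linear u B ->
  total xs u <= B * \sum_(x <- xs) rnorm x.
Proof. by move=> [_ Hu]; rewrite mulr_sumr; apply: ler_sum. Qed.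

Lemma total_scale xs (u : V -> Y) (r : R) :
  total xs (fun x => of_real s r *: u x) = `|r| * total xs u.
Proof. by rewrite mulr_sumr; apply: eq_bigr => x _; rewrite rnormZr. Qed.

Lemma total_triangle xs (u v w : V -> Y) : (forall x, u x = v x + w x) ->
  total xs u <= total xs v + total xs w.
Proof.
by move=> H; rewrite -big_split; apply: ler_sum => x _; rewrite H rnormD.
Qed.

(** An operator [v] in the unit ball that almost attains the supremum [P] of the
    sums over a fixed family. *)
Lemma summing_almost_extremal (k : R) (xs : seq V) (u : V -> Y) :
  0 <= k -> bounded_linear u 1 -> k < total xs u ->
  exists (P : R) (v : V -> Y), [/\ k <= P, bounded_linear v 1,
    2 / 3 * P <= total xs v &
    forall (w : V -> Y) (B : R), 0 <= B -> bounded_linear w B -> total xs w <= B * P].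
Proof.
move=> k0 Hu ku; pose A := [set total xs v | v in [set v : V -> Y | bounded_linear v 1]].
have hs : has_sup A.
  split; first by exists (total xs u), u.
  exists (\sum_(x <- xs) rnorm x) => _ [v /= Hv <-].
  by rewrite (le_trans (total_bounded xs Hv)) // mul1r.
have kP : k < sup A by rewrite (lt_le_trans ku) //; apply: sup_upper_bound => //; exists u.
have P3 : 0 < sup A / 3 by rewrite divr_gt0 // (le_lt_trans k0).
have [_ [v /= Hv <-] hv] := sup_adherent P3 hs.
exists (sup A), v; split => //; first exact: ltW.
  by rewrite (le_trans _ (ltW hv)) // (_ : _ - _ = 2 / 3 * sup A) //; field.
move=> w B; rewrite le_eqVlt => /predU1P[<- Hw|B0 Hw].
  by rewrite (le_trans (total_bounded xs Hw)) // !mul0r.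
have B0' : 0 <= B^-1 by rewrite invr_ge0 ltW.
rewrite -ler_pdivrMl // -[B^-1]ger0_norm // -total_scale.
apply: sup_upper_bound => //; exists (fun x => of_real s B^-1 *: w x) => //=.
have := bounded_linearZ (of_real s B^-1) Hw.
by rewrite sabs_of_real ger0_norm ?invr_ge0 ?ltW // mulVf ?gt_eqF.
Qed.

Theorem uniform_summing : exists2 k : R, 0 <= k &
  forall (u : V -> Y) (B : R), 0 <= B -> bounded_linear u B -> summing u (k * B).
Proof.
apply: contrapT => H.
(* the factor $n + 1$ on top of $3^n$ outweighs the coefficient $3^{-n}$ of the
   $n$-th operator *)
have step (n : nat) : exists t : seq V * R * (V -> Y),
    [/\ weak_l1_le t.1.1 1, n.+1%:R * 3 ^+ n <= t.1.2, bounded_linear t.2 1,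
      2 / 3 * t.1.2 <= total t.1.1 t.2 &
    forall (w : V -> Y) (B : R), 0 <= B -> bounded_linear w B ->
      total t.1.1 w <= B * t.1.2].
  have k0 : 0 <= n.+1%:R * 3 ^+ n :> R by rewrite mulr_ge0 // exprn_ge0.
  have [|xs [u [Hxs Hu lt]]] := @summing_large_sum _ k0.
    apply: contrapT => H'; apply: H; exists (n.+1%:R * 3 ^+ n) => // u B B0 Hu.
    by apply: contrapT => H''; apply: H'; exists u, B.
  have [P [v [h1 h2 h3 h4]]] := summing_almost_extremal k0 Hu lt.
  by exists (xs, P, v).
have [g Hg] := choice step.
pose xs n := (g n).1.1; pose P n := (g n).1.2.
pose v n x := of_real s (3^-1 ^+ n) *: (g n).2 x.
have q0 n : 0 <= 3^-1 ^+ n :> R by rewrite exprn_ge0 // invr_ge0.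
have Hv n : bounded_linear (v n) (3^-1 ^+ n).
  have [_ _ h _ _] := Hg n; have := bounded_linearZ (of_real s (3^-1 ^+ n)) h.
  by rewrite sabs_of_real mulr1 ger0_norm.
pose fix S n : V -> Y := if n is m.+1 then
    if total (xs m) (v m) <= total (xs m) (fun x => S m x + v m x)
    then fun x => S m x + v m x else fun x => S m x - v m x
  else fun=> 0.
have incr n x : rnorm (S n.+1 x - S n x) = rnorm (v n x).
  by rewrite /=; case: ifP => _; rewrite addrAC subrr add0r // rnormN.
have linS n : linear (S n).
  elim: n => [|n IH]; first by move=> a x y; rewrite /= scaler0 addr0.
  have lv := proj1 (Hv n).
  rewrite /=; case: ifP => _ a x y; rewrite IH lv.
    by rewrite scalerDr addrACA.
  by rewrite opprD scalerBr addrACA.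
(* by the choice of the sign *)
have big n : total (xs n) (v n) <= total (xs n) (S n.+1).
  rewrite /=; case: ifPn => //; rewrite -ltNge => lt.
  have : total (xs n) (fun x => v n x + v n x) <=
      total (xs n) (fun x => S n x + v n x) + total (xs n) (fun x => S n x - v n x).
    rewrite -big_split; apply: ler_sum => x _ /=.
    rewrite (_ : v n x + v n x = (S n x + v n x) - (S n x - v n x)) ?rnormB //.
    by rewrite opprB (addrC (S n x)) addrACA subrr addr0.
  have -> : total (xs n) (fun x => v n x + v n x) = total (xs n) (v n) + total (xs n) (v n).
    by rewrite -big_split; apply: eq_bigr => x _ /=; rewrite rnorm_double mulr_natl mulr2n.
  by move: lt; lra.
have sum_q n : \sum_(k < n) 3^-1 ^+ k = 3 / 2 - 3 / 2 * 3^-1 ^+ n :> R.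
  elim: n => [|n IH]; first by rewrite big_ord0 expr0; ring.
  by rewrite big_ord_recr /= IH exprS; field.
have lim x : exists l, rcvg (S ^~ x) l /\
    forall n, rnorm (l - S n x) <= 3 / 2 * 3^-1 ^+ n * rnorm x.
  have [||l Hl Hl'] := rcomplete_tele (rcomplete (V := Y)) (w := S ^~ x)
     (c := fun n => 3^-1 ^+ n * rnorm x) (B := 3 / 2 * rnorm x).
  - by move=> n; rewrite incr; apply: (proj2 (Hv n)).
  - move=> n; rewrite -mulr_suml ler_wpM2r ?rnorm_ge0 // sum_q gerBl.
    by rewrite mulr_ge0 // divr_ge0.
  exists l; split=> // n; have := Hl' n.
  by rewrite -mulr_suml sum_q mulrBl opprB addrCA subrr addr0.
have [T HT] := choice lim.
have linT : linear T.
  move=> a x y; apply: (rcvg_unique (proj1 (HT _))).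
  apply: (@rcvg_ext _ _ _ (fun n => a *: S n x + S n y)).
    by move=> n; rewrite linS.
  by apply: rcvgD; [apply: rcvgZ; exact: (proj1 (HT _)) | exact: (proj1 (HT _))].
have HD n : bounded_linear (fun x => S n x - T x) (3 / 2 * 3^-1 ^+ n).
  split=> [a x y|x].
    by rewrite linS linT opprD scalerBr addrACA.
  by rewrite rnormB_sym (proj2 (HT x)).
have [C HC] : exists C, summing T C.
  apply: (all_summing (B := 3 / 2)); split => // x.
  by have := proj2 (HT x) 0%N; rewrite subr0 expr0 mulr1.
(* the tail of the series costs at most $\frac12 3^{-n} P_n$, while the $n$-th
   term contributes at least $\frac23 3^{-n} P_n$ *)
have low n : n.+1%:R <= 6 * C.
  have [h1 h2 h3 h4 h5] := Hg n.
  have t1 : total (xs n) (S n.+1) <= total (xs n) T +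
      total (xs n) (fun x => S n.+1 x - T x).
    by apply: total_triangle => x; rewrite addrC subrK.
  have t2 := h5 _ _ _ (HD n.+1); have t3 := HC _ _ h1; rewrite mulr1 in t3.
  have t4 := big n; rewrite total_scale ger0_norm // in t4.
  have q1 : 3^-1 ^+ n * 3 ^+ n = 1 :> R by rewrite -exprMn mulVf ?expr1n ?pnatr_eq0.
  have t5 : 3^-1 ^+ n * (2 / 3 * P n) <= 3^-1 ^+ n * total (xs n) (g n).2.
    by rewrite ler_wpM2l.
  have t6 : 3^-1 ^+ n * (n.+1%:R * 3 ^+ n) <= 3^-1 ^+ n * P n by rewrite ler_wpM2l.
  rewrite mulrCA q1 mulr1 in t6.
  have t7 : total (xs n) (fun x => S n.+1 x - T x) <= 1 / 2 * (3^-1 ^+ n * P n).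
    rewrite (le_trans (t2 _)) ?mulr_ge0 ?divr_ge0 // exprS le_eqVlt.
    by apply/orP; left; apply/eqP; rewrite /P; field.
  have t8 : 3^-1 ^+ n * (2 / 3 * P n) = 2 / 3 * (3^-1 ^+ n * P n) by rewrite mulrCA.
  by move: t1 t3 t4 t5 t6 t7 t8; rewrite -/(xs n); lra.
by have := low (Num.truncn (6 * C)); rewrite leNgt truncnS_gt.
Qed.

End UniformSumming.

End Summing.

(** * From multilinear to linear operators *)

Section Multilinear.
Variables (R : realType) (s : scalar_kind) (m : nat).
Local Notation K := (scalar_field R s).

Lemma ptws_cvg (X : normedModType K) (u : nat -> {ptws 'I_m -> X})
    (x : {ptws 'I_m -> X}) :
  (forall k, rcvg (fun n => u n k) (x k)) -> u @ \oo --> x.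
Proof.
move=> H; apply/cvg_sup => k; apply/cvg_image.
  by rewrite eqEsubset; split=> v // _; exists (fun=> v).
have /rcvgP h := H k.
move=> A /h [N _ HN]; exists [set f | A (f k)]; first by exists N.
rewrite eqEsubset; split=> [_ [f /= Af <-] //|v Av].
by exists (fun=> v).
Qed.

Lemma linearB_fun (X Y : normedModType K) (u : X -> Y) x y :
  linear u -> u (x - y) = u x - u y.
Proof.
move=> lu; rewrite linearD_fun // -scaleN1r linearZ_fun //.
by rewrite scaleN1r.
Qed.

Lemma bounded_operator_continuous (X Y : normedModType K) (u : X -> Y) B :
  bounded_linear u B -> continuous u.
Proof.
move=> [lu Hu] x; apply/cvgrPdist_lt => _ /pos_of_real[r r0 ->].
have B0 : 0 < `|B| + 1 by rewrite ltr_wpDl.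
have d0 : 0 < of_real s (r / (`|B| + 1)).
  by rewrite -(of_real0 R s) ltr_of_real divr_gt0.
near=> y; rewrite -linearB_fun // rnorm_lt.
rewrite (le_lt_trans (Hu _)) // (le_lt_trans (y := (`|B| + 1) * rnorm (x - y))) //.
  by rewrite ler_wpM2r ?rnorm_ge0 // (le_trans (ler_norm _)) // lerDl.
rewrite mulrC -ltr_pdivlMr // -rnorm_lt.
by near: y; apply: cvgr_dist_lt.
Unshelve. all: by end_near. Qed.

Lemma prod_forms_continuous (X : normedModType K) (psi : X -> K^o) B (r : seq 'I_m)
  (P : pred 'I_m) : bounded_linear psi B ->
  continuous (fun x : {ptws 'I_m -> X} => \prod_(k <- r | P k) psi (x k) : K).
Proof.
move=> /bounded_operator_continuous cpsi x.
elim: r => [|k r IH].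
  rewrite (_ : (fun _ => _) = fun=> 1); last by apply/funext => y; rewrite big_nil.
  exact: (@cst_continuous {ptws 'I_m -> X} K 1 x).
rewrite (_ : (fun _ => _) = (fun y : {ptws 'I_m -> X} =>
  (if P k then psi (y k) else 1 : K) * \prod_(k <- r | P k) psi (y k))); last first.
  by apply/funext => y; rewrite big_cons; case: ifP; rewrite ?mul1r.
have c1 : continuous_at x (fun y : {ptws 'I_m -> X} => if P k then psi (y k) else 1 : K).
  case: (P k); last exact: (@cst_continuous {ptws 'I_m -> X} K 1 x).
  apply: (@continuous_comp _ _ _ (fun y : {ptws 'I_m -> X} => y k) psi); last exact: cpsi.
  exact: (@proj_continuous 'I_m (fun _ => X) k).
exact: (continuousM c1 IH).
Qed.

Lemma multilinear_scale (X Y : normedModType K) (T : ('I_m -> X) -> Y)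
    (c : 'I_m -> K) (x : 'I_m -> X) : multilinear T ->
  T (fun k => c k *: x k) = (\prod_k c k) *: T x.
Proof.
move=> lT.
have step (r : seq 'I_m) : uniq r ->
    T (fun k => if k \in r then c k *: x k else x k) = (\prod_(k <- r) c k) *: T x.
  elim: r => [_|k r IH /= /andP[kr ur]]; first by rewrite big_nil scale1r.
  rewrite big_cons -scalerA -IH //.
  pose z l := if l \in r then c l *: x l else x l.
  have := linearZ_fun (c k) (x k) (lT k z) => /= h.
  rewrite (_ : (fun l => _) = (fun l => if l == k then c k *: x k else z l)).
    rewrite h; congr (_ *: T _); apply/funext => l; rewrite /z.
    by case: eqP => [->|//]; rewrite (negbTE kr).
  by apply/funext => l; rewrite inE; case: eqP => [->|].
rewrite -(step (index_enum 'I_m) (index_enum_uniq _)); congr (T _).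
by apply/funext => k; rewrite mem_index_enum.
Qed.

(** A continuous multilinear form is bounded on the product of the unit balls. *)
Lemma continuous_multilinear_bounded (X Y : normedModType K)
    (T : {ptws 'I_m -> X} -> Y) : (0 < m)%N -> continuous_multilinear T ->
  exists B : R, forall x, (forall k, rnorm (x k) <= 1) -> rnorm (T x) <= B.
Proof.
move=> hm [lT cT]; apply: contrapT => /forallNP H.
have {}H (n : nat) : exists x : 'I_m -> X, (forall k, rnorm (x k) <= 1) /\
    n.+1%:R ^+ m < rnorm (T x).
  have /existsNP[x /not_implyP[h1 /negP]] := H (n.+1%:R ^+ m).
  by rewrite -ltNge => h2; exists x.
have [x Hx] := choice H.
(* the rescaled vectors tend to $0$, but their images do not *)
pose y n : {ptws 'I_m -> X} := fun k => of_real s n.+1%:R^-1 *: x n k.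
have T0 : T (fun=> 0) = 0.
  rewrite -[RHS](linear0_fun (lT (Ordinal hm) (fun=> 0))); congr (T _).
  by apply/funext => k; case: ifP.
have yc : y @ \oo --> ((fun=> 0) : {ptws 'I_m -> X}).
  apply: ptws_cvg => k e e0; exists (Num.truncn e^-1) => n nN.
  rewrite subr0 rnormZr ger0_norm ?invr_ge0 // ler_pdivrMl //.
  rewrite (le_trans (proj1 (Hx n) k)) // -ler_pdivrMr // mul1r.
  by rewrite (le_trans (ltW (truncnS_gt _))) // ler_nat.
have /rcvgP/(_ 1 ltr01)[N HN] : (T \o y) @ \oo --> T (fun=> 0).
  exact: cvg_comp yc (cT _).
have := HN N (leqnn N); rewrite T0 subr0 /=.
rewrite (_ : T (y N) = (\prod_(k < m) of_real s N.+1%:R^-1) *: T (x N)); last first.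
  exact: multilinear_scale.
rewrite rnormZs prodr_const card_ord sabsX sabs_of_real ger0_norm ?invr_ge0 //.
rewrite exprVn ler_pdivrMl ?exprn_gt0 // mulr1 leNgt => /negP; apply.
exact: (proj2 (Hx N)).
Qed.

Lemma unit_form_le (X : normedModType K) (phi : {ptws 'I_m -> X} -> K^o)
    (x : 'I_m -> X) : (0 < m)%N -> unit_forms phi ->
  rnorm (phi x) <= \prod_k rnorm (x k).
Proof.
move=> hm [cphi phi1]; have [B HB] := continuous_multilinear_bounded hm cphi.
have unit y : (forall k, rnorm (y k) <= 1) -> rnorm (phi y) <= 1.
  move=> y1; rewrite (le_trans _ phi1) //; apply: sup_upper_bound; last by exists y.
  by split; [exists (rnorm (phi y)), y | exists B => _ [z /HB ? <-]].
pose y k := of_real s (rnorm (x k))^-1 *: x k.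
have xE k : x k = of_real s (rnorm (x k)) *: y k.
  rewrite /y scalerA -of_realM.
  have [->|xk] := eqVneq (x k) 0; first by rewrite scaler0.
  by rewrite mulfV ?of_real1 ?scale1r // gt_eqF // rnorm_gt0.
have yle k : rnorm (y k) <= 1.
  rewrite /y rnormZr ger0_norm ?invr_ge0 ?rnorm_ge0 //.
  by have [->|xk] := eqVneq (rnorm (x k)) 0; rewrite ?mulr0 // mulVf.
have -> : phi x = (\prod_k of_real s (rnorm (x k))) *: (phi y : K^o).
  rewrite -(multilinear_scale _ _ (proj1 cphi)); congr (phi _).
  by apply/funext => k.
rewrite rnormZs sabs_prod (eq_bigr (fun k => rnorm (x k))); last first.
  by move=> k _; rewrite sabs_of_real ger0_norm ?rnorm_ge0.
by rewrite ler_piMr ?unit //; apply: prodr_ge0 => k _; exact: rnorm_ge0.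
Qed.

(** If all continuous multilinear operators are factorable strongly
    $1$-summing, then all bounded linear operators are absolutely summing:
    extend the linear operator $u$ to
    $T(x_1, \dots, x_m) = \psi(x_2) \cdots \psi(x_m) u(x_1)$. *)
Theorem factorable_linear_summing (X Y : normedModType K) (psi : X -> K^o) (A : R)
    (a : X) (u : X -> Y) (B : R) : (0 < m)%N ->
  bounded_linear psi A -> psi a = 1 ->
  @factorable_strongly_summing R s m 1 X Y = @continuous_multilinear R s m X Y ->
  bounded_linear u B -> exists C, summing u C.
Proof.
move=> hm Hpsi psia hFSt Hu; pose k0 := Ordinal hm.
pose c (x : 'I_m -> X) : K := \prod_(k | k != k0) psi (x k).
pose T (x : {ptws 'I_m -> X}) : Y := c x *: u (x k0).
have cT : continuous_multilinear T.
  split.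
    move=> k x a1 v w; rewrite /T /=.
    have [->|kk0] := eqVneq k k0.
      have ce z : c (fun l => if l == k0 then z else x l) = c x.
        by apply: eq_bigr => l /negbTE ->.
      by rewrite !ce (proj1 Hu) scalerDr !scalerA mulrC.
    have ce z : c (fun l => if l == k then z else x l) =
        psi z * \prod_(l | (l != k0) && (l != k)) psi (x l).
      rewrite /c (bigD1 k) //= eqxx; congr (_ * _); apply: eq_bigr => l /andP[_ /negbTE ->] //.
    rewrite !ce (proj1 Hpsi) mulrDl scalerDl scalerA; congr (_ *: _ + _).
    by rewrite mulrA.
  move=> x.
  have c1 : continuous_at x (fun y : {ptws 'I_m -> X} => u (y k0)).
    apply: (@continuous_comp _ _ _ (fun y : {ptws 'I_m -> X} => y k0) u).
      exact: (@proj_continuous 'I_m (fun _ => X) k0).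
    exact: (bounded_operator_continuous Hu).
  have c2 : continuous_at x (fun y : {ptws 'I_m -> X} => c y : K).
    exact: prod_forms_continuous Hpsi x.
  exact: (continuousZ c2 c1).
have [_ [C C0 HC]] : factorable_strongly_summing 1 T by rewrite hFSt.
have a0 : 0 < rnorm a.
  apply: rnorm_gt0; apply: contra_eq_neq psia => ->.
  by rewrite (linear0_fun (proj1 Hpsi)) eq_sym oner_eq0.
pose D : R := rnorm a ^+ m.-1; have D0 : 0 < D by rewrite exprn_gt0.
have D0' := ltW D0; exists (C * D) => xs W HW; have W0 := weak_l1_ge0 HW.
have [xs0|xs0] := posnP (size xs).
  by rewrite (size0nil xs0) big_nil !mulr_ge0.
pose t v : {ptws 'I_m -> X} := fun k => if k == k0 then v else a.
have := HC (size xs) 1%N xs0 isT (fun _ _ => 1) (fun j _ => t (nth 0 xs j)).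
have wE (W' : normedModType K) (S : {ptws 'I_m -> X} -> W') :
    weak_sum 1 (fun _ _ => 1) (fun (j : 'I_(size xs)) (_ : 'I_1) => t (nth 0 xs j)) S =
    \sum_(v <- xs) rnorm (S (t v)).
  rewrite /weak_sum invr1 powRr1.
    rewrite (big_nth 0) big_mkord; apply: eq_bigr => j _.
    by rewrite big_ord1 scale1r powRr1 // rnorm_ge0.
  by apply: sumr_ge0 => j _; rewrite powR_ge0.
rewrite wE => h.
have -> : \sum_(v <- xs) rnorm (u v) = \sum_(v <- xs) rnorm (T (t v)).
  apply: eq_bigr => v _; rewrite /T /c /t eqxx big1 ?scale1r // => k /negbTE -> //.
rewrite (le_trans h) // -mulrA ler_wpM2l //.
set S := (X in sup X); have [->|/set0P S0] := eqVneq S set0.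
  by rewrite sup0 mulr_ge0.
apply: ge_sup => // _ [phi Hphi <-]; rewrite wE.
have := HW (fun v => of_real s D^-1 *: (phi (t v) : K^o)).
have D1 : 0 <= D^-1 by rewrite invr_ge0 ltW.
have Ht : bounded_linear (fun v => of_real s D^-1 *: (phi (t v) : K^o)) 1.
  split=> [b v w|v].
    have := proj1 (proj1 Hphi) k0 (fun=> a) b v w; rewrite /= -/(t _) => h1.
    by rewrite [phi _]h1 scalerDr !scalerA mulrC.
  rewrite rnormZr ger0_norm // mul1r ler_pdivrMl //.
  rewrite (le_trans (unit_form_le _ hm Hphi)) // (bigD1 k0) //= mulrC.
  rewrite {2}/t eqxx (eq_bigr (fun=> rnorm a)) => [|k /negbTE k0k]; last first.
    by rewrite /t k0k.
  by rewrite prodr_const cardC1 card_ord.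
move=> /(_ Ht); rewrite (eq_bigr (fun v => D^-1 * rnorm (phi (t v)))).
  by rewrite -mulr_sumr ler_pdivrMl.
by move=> v _; rewrite /sabs rnormZr ger0_norm.
Qed.

End Multilinear.

(** * The Dvoretzky-Rogers lemma *)

Section RealSpan.
Variables (R : realType) (s : scalar_kind).
Local Notation K := (scalar_field R s).
Variable Y : normedModType K.

(** The real linear combination of the [v i] with coefficients [t]. *)
Definition rcomb (N : nat) (v : nat -> Y) (t : nat -> R) : Y :=
  \sum_(i < N) of_real s (t i) *: v i.

Lemma real_complete (f : nat -> R) :
  (forall e : R, 0 < e -> exists N, forall n, (N <= n)%N -> `|f n - f N| <= e) ->
  exists l, forall e : R, 0 < e -> exists N, forall n, (N <= n)%N -> `|f n - l| <= e.
Proof.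
move=> H; have := @rcomplete R RealScalars (R : completeNormedModType R).
by move=> /(_ f H)[l Hl]; exists l.
Qed.

Lemma inv_nat_small (C e : R) : 0 < e -> exists N, forall n, (N <= n)%N ->
  C * n.+1%:R^-1 <= e.
Proof.
move=> e0; exists (Num.truncn (`|C| / e)) => n nN.
rewrite ler_pdivrMr // (le_trans (ler_norm _)) // -ler_pdivrMl // mulrC.
by rewrite (le_trans (ltW (truncnS_gt _))) // ler_nat.
Qed.

(** A vector outside the span of a system with bounded coordinates has a
    positive distance to its real span. *)
Lemma dist_span_gt0 (N : nat) (v : nat -> Y) (c : R) (w : Y) : 0 <= c ->
  (forall t i, (i < N)%N -> `|t i| <= c * rnorm (rcomb N v t)) ->
  (forall t, w <> rcomb N v t) ->
  exists2 d : R, 0 < d & forall t, d <= rnorm (w - rcomb N v t).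
Proof.
move=> c0 Hc Hw; apply: contrapT => H.
have {}H (n : nat) : exists t, rnorm (w - rcomb N v t) <= n.+1%:R^-1.
  apply: contrapT => H'; apply: H; exists n.+1%:R^-1 => // t.
  by rewrite leNgt; apply/negP => h; apply: H'; exists t; exact: ltW.
have [t Ht] := choice H.
have lim i : exists l : R, (i < N)%N -> forall e : R, 0 < e ->
    exists M, forall n, (M <= n)%N -> `|t n i - l| <= e.
  have [iN|iN] := ltnP i N; last by exists 0.
  have [|l Hl] := @real_complete (fun n => t n i); last by exists l.
  move=> e e0; have [M HM] := inv_nat_small (2 * c) e0; exists M => n nM.
  rewrite (le_trans (Hc (fun i => t n i - t M i) _ iN)) // (le_trans _ (HM M (leqnn M))) //.
  have -> : rcomb N v (fun i => t n i - t M i) = (w - rcomb N v (t M)) - (w - rcomb N v (t n)).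
    rewrite opprB addrC addrA subrK.
    by rewrite /rcomb -sumrB; apply: eq_bigr => j _; rewrite of_realB scalerBl.
  rewrite (mulrC 2) -mulrA ler_wpM2l // mulr_natl mulr2n.
  rewrite (le_trans (rnormB _ _)) // lerD // (le_trans (Ht n)) //.
  by rewrite lef_pV2 ?posrE // ler_nat.
have [l Hl] := choice lim.
apply: (Hw l); apply: (@rcvg_unique _ _ _ (fun n => rcomb N v (t n))).
  move=> e e0; have [M HM] := inv_nat_small 1 e0; exists M => n /HM.
  by rewrite mul1r rnormB_sym; exact: le_trans.
apply: rcvg_sum => i e e0.
have vi : 0 < rnorm (v i) + 1 by rewrite ltr_wpDl ?rnorm_ge0.
have [M HM] := Hl i (ltn_ord i) _ (divr_gt0 e0 vi); exists M => n /HM h.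
rewrite -scalerBl -of_realB rnormZr (le_trans (ler_wpM2r (rnorm_ge0 _) h)) //.
by rewrite mulrAC ler_pdivrMr // ler_wpM2l ?lerDl // ltW.
Qed.

(** An infinite-dimensional space contains arbitrarily long systems with
    bounded coordinates. *)
Lemma bounded_coordinates_system (N : nat) : infinite_dimensional Y ->
  exists (v : nat -> Y) (c : R), 0 <= c /\
    forall t i, (i < N)%N -> `|t i| <= c * rnorm (rcomb N v t).
Proof.
move=> infY; elim: N => [|N [v [c [c0 Hc]]]].
  by exists (fun=> 0), 0.
have [w Hw] : exists w, forall t : nat -> R, w <> rcomb N v t.
  apply: contrapT => H; apply: infY; exists N, (fun i : 'I_N => v i) => x.
  apply: contrapT => H'; apply: H; exists x => t xt; apply: H'.
  by exists (fun i => of_real s (t i)).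
have [d d0 Hd] := dist_span_gt0 c0 Hc Hw.
pose v' i := if (i < N)%N then v i else w.
have v'E t : rcomb N.+1 v' t = rcomb N v t + of_real s (t N) *: w.
  rewrite /rcomb big_ord_recr /= /v' ltnn; congr (_ + _); apply: eq_bigr => i _.
  by rewrite ltn_ord.
have last t : `|t N| <= d^-1 * rnorm (rcomb N.+1 v' t).
  rewrite ler_pdivlMl // v'E; have [->|tN] := eqVneq (t N) 0.
    by rewrite normr0 mulr0 rnorm_ge0.
  have -> : rcomb N v t + of_real s (t N) *: w =
      of_real s (t N) *: (w - rcomb N v (fun i => - (t i / t N))).
    rewrite scalerBr addrC; congr (_ + _); rewrite /rcomb scaler_sumr -sumrN.
    apply: eq_bigr => i _; rewrite scalerA -of_realM -scaleNr -of_realN mulrN opprK.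
    by rewrite mulrCA mulfV ?mulr1.
  by rewrite rnormZr mulrC ler_wpM2l.
exists v', (d^-1 + c * (1 + rnorm w / d)); split.
  by rewrite addr_ge0 ?mulr_ge0 ?addr_ge0 ?divr_ge0 ?rnorm_ge0 ?invr_ge0 ?(ltW d0).
move=> t i; rewrite ltnS leq_eqVlt => /predU1P[->|iN].
  rewrite (le_trans (last t)) // ler_wpM2r ?rnorm_ge0 // lerDl.
  by rewrite mulr_ge0 ?addr_ge0 ?divr_ge0 ?rnorm_ge0 ?(ltW d0).
set S := rnorm (rcomb N.+1 v' t); have S0 : 0 <= S by exact: rnorm_ge0.
have h1 : rnorm (rcomb N v t) <= S + rnorm w / d * S.
  have -> : rcomb N v t = rcomb N.+1 v' t - of_real s (t N) *: w by rewrite v'E addrK.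
  rewrite (le_trans (rnormB _ _)) // lerD2l rnormZr.
  by rewrite mulrC -mulrA ler_wpM2l ?rnorm_ge0 // last.
rewrite (le_trans (Hc t i iN)) // (le_trans (ler_wpM2l c0 h1)) //.
rewrite (_ : S + _ = (1 + rnorm w / d) * S); last by rewrite mulrDl mul1r.
by rewrite mulrA ler_wpM2r // lerDr invr_ge0 ltW.
Qed.

End RealSpan.

Section Determinant.
Variable R : realType.

(** For a matrix $F$ with $j$ orthonormal rows, $2 - F^T F$ is $1$ plus the
    orthogonal projection onto the complement of the row space, whence its
    determinant is $2^{N-j}$. This is read off two factorizations of a block
    matrix. *)
Lemma det_orthonormal_rows (j N : nat) (F : 'M[R]_(j, N)) : F *m F^T = 1%:M ->
  \det (2%:M - F^T *m F) * 2 ^+ j = 2 ^+ N.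
Proof.
move=> FF; pose M := block_mx (1%:M : 'M[R]_j) F F^T (2%:M : 'M[R]_N).
have e1 : \det M = \det (2%:M - F^T *m F).
  have -> : M = block_mx 1%:M 0 F^T 1%:M *m block_mx 1%:M F 0 (2%:M - F^T *m F).
    rewrite mulmx_block !mul1mx !mulmx1 !mul0mx !addr0.
    by rewrite addrC subrK.
  by rewrite det_mulmx det_lblock det_ublock !det1 !mul1r.
have e2 : \det M = 2^-1 ^+ j * 2 ^+ N.
  have -> : M = block_mx 1%:M (2^-1 *: F) 0 1%:M *m block_mx (2^-1)%:M 0 F^T 2%:M.
    rewrite mulmx_block !mul1mx !mul0mx !add0r -scalemxAl FF.
    rewrite -scalemxAl mul_mx_scalar scalerA mulVf ?pnatr_eq0 // scale1r.
    by rewrite scalemx1 -raddfD /= (_ : 2^-1 + 2^-1 = 1 :> R) //; field.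
  by rewrite det_mulmx det_ublock det_lblock !det1 !mul1r !det_scalar.
rewrite -e1 e2 mulrAC -exprMn mulVf ?pnatr_eq0 // expr1n mul1r //.
Qed.

(** The square of the Euclidean norm of a row vector. *)
Definition sqn (N : nat) (t : 'rV[R]_N) : R := (t *m t^T) 0 0.

Lemma sqnE N (t : 'rV[R]_N) : sqn t = \sum_i t 0 i ^+ 2.
Proof. by rewrite /sqn mxE; apply: eq_bigr => i _; rewrite mxE -expr2. Qed.

Lemma sqn_ge0 N (t : 'rV[R]_N) : 0 <= sqn t.
Proof. by rewrite sqnE; apply: sumr_ge0 => i _; exact: sqr_ge0. Qed.

Lemma sqn_eq0 N (t : 'rV[R]_N) : sqn t = 0 -> t = 0.
Proof.
rewrite sqnE => /eqP; rewrite psumr_eq0 => [/allP H|i _]; last exact: sqr_ge0.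
apply/rowP => i; rewrite mxE; apply/eqP; rewrite -sqrf_eq0.
by apply: (H i); rewrite mem_index_enum.
Qed.

Lemma sqnZ N (a : R) (t : 'rV[R]_N) : sqn (a *: t) = a ^+ 2 * sqn t.
Proof.
by rewrite /sqn linearZ /= -scalemxAl -scalemxAr scalerA !mxE -expr2.
Qed.

End Determinant.

Section DvoretzkyRogers.
Variables (R : realType) (s : scalar_kind).
Local Notation K := (scalar_field R s).
Variables (Y : normedModType K) (N : nat) (v : nat -> Y) (c : R).
Hypothesis c_ge0 : 0 <= c.
Hypothesis coord_le : forall t i, (i < N)%N -> `|t i| <= c * rnorm (rcomb N v t).

(** The linear map from the Euclidean space to the span of [v]. *)
Definition comb_row (t : 'rV[R]_N) : Y := \sum_i of_real s (t 0 i) *: v i.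

Lemma comb_rowD (t u : 'rV[R]_N) : comb_row (t + u) = comb_row t + comb_row u.
Proof.
rewrite /comb_row -big_split; apply: eq_bigr => i _ /=.
by rewrite mxE of_realD scalerDl.
Qed.

Lemma comb_rowZ (a : R) (t : 'rV[R]_N) : comb_row (a *: t) = of_real s a *: comb_row t.
Proof.
rewrite /comb_row scaler_sumr; apply: eq_bigr => i _.
by rewrite mxE of_realM scalerA.
Qed.

Lemma comb_row_coord (t : 'rV[R]_N) (i : 'I_N) : `|t 0 i| <= c * rnorm (comb_row t).
Proof.
pose f n := if insub n is Some i then t 0 i else 0 : R.
have fE (k : 'I_N) : f k = t 0 k by rewrite /f valK.
have := coord_le f (ltn_ord i); rewrite fE /rcomb.
by rewrite (eq_bigr (fun k : 'I_N => of_real s (t 0 k) *: v k)) // => k _; rewrite fE.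
Qed.

(** The matrices that induce a contraction from the Euclidean space to [Y]. *)
Definition contractive (A : 'M[R]_N) := forall t, rnorm (comb_row (t *m A)) ^+ 2 <= sqn t.

Lemma contractive_det (A : 'M[R]_N) : contractive A -> `|\det A| <= \sum_(p : 'S_N) c ^+ N.
Proof.
move=> cA; have entry i j : `|A i j| <= c.
  have := cA (delta_mx 0 i); rewrite -rowE sqnE (bigD1 i) //= big1 ?addr0; last first.
    by move=> k ki; rewrite mxE eqxx (negbTE ki) expr0n.
  rewrite mxE !eqxx expr1n expr_le1 ?rnorm_ge0 // => h.
  have := comb_row_coord (row i A) j; rewrite mxE => /le_trans; apply.
  by rewrite ler_piMr.
rewrite (le_trans (ler_norm_sum _ _ _)) //; apply: ler_sum => p _.
rewrite normrM normrX normrN1 expr1n mul1r normr_prod.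
rewrite -[N in c ^+ N]card_ord -prodr_const; apply: ler_prod => i _.
by rewrite normr_ge0 entry.
Qed.

Lemma contractive_exists : exists2 A, contractive A & 0 < `|\det A|.
Proof.
pose B := \sum_(i < N) rnorm (v i) + 1.
have B0 : 0 < B by rewrite ltr_wpDl // sumr_ge0 // => i _; exact: rnorm_ge0.
exists (B^-1)%:M; last by rewrite det_scalar normr_gt0 expf_neq0 // invr_eq0 gt_eqF.
move=> t; rewrite mul_mx_scalar comb_rowZ rnormZr ger0_norm ?invr_ge0 ?(ltW B0) //.
rewrite -[leRHS]sqr_sqrtr ?sqn_ge0 // ler_pXn2r ?nnegrE ?sqrtr_ge0 //; last first.
  by rewrite mulr_ge0 ?rnorm_ge0 // invr_ge0 ltW.
rewrite ler_pdivrMl // mulrC (le_trans (rnorm_sum _ _ _)) //.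
have -> : Num.sqrt (sqn t) * B =
    \sum_(i < N) Num.sqrt (sqn t) * rnorm (v i) + Num.sqrt (sqn t).
  by rewrite -mulr_sumr mulrDr mulr1.
rewrite -[leLHS]addr0 lerD ?sqrtr_ge0 //; apply: ler_sum => i _.
rewrite rnormZr ler_wpM2r ?rnorm_ge0 //.
rewrite -sqrtr_sqr ler_sqrt ?sqn_ge0 // sqnE (bigD1 i) //= lerDl.
by apply: sumr_ge0 => k _; exact: sqr_ge0.
Qed.

(** An almost maximal determinant among the contractions. *)
Lemma contractive_almost_max : exists (A : 'M[R]_N) (D : R), [/\ contractive A, 0 < D,
  7 / 8 * D < `|\det A| & forall B, contractive B -> `|\det B| <= D].
Proof.
pose S := [set `|\det A| | A in [set A | contractive A]].
have [A0 cA0 dA0] := contractive_exists.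
have hs : has_sup S.
  split; first by exists `|\det A0|, A0.
  by exists (\sum_(p : 'S_N) c ^+ N) => _ [A /= /contractive_det h <-].
have ub B : contractive B -> `|\det B| <= sup S.
  by move=> cB; apply: sup_upper_bound => //; exists B.
have D0 : 0 < sup S by rewrite (lt_le_trans dA0) // ub.
have [_ [A /= cA <-] hA] := sup_adherent (divr_gt0 D0 (ltr0n R 8)) hs.
exists A, (sup S); split => //; rewrite (le_lt_trans _ hA) // le_eqVlt.
by apply/orP; left; apply/eqP; field.
Qed.

Lemma comb_row0 : comb_row 0 = 0.
Proof. by rewrite -(scale0r (0 : 'rV[R]_N)) comb_rowZ of_real0 scale0r. Qed.

(** On the orthogonal complement of fewer than $N / 2$ orthonormal vectors, an
    almost extremal contraction $A$ has norm at least $1 / 4$. Otherwise, with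
    $P$ the orthogonal projection onto this complement, $\frac45 (1 + P) A$
    would be a contraction with a larger determinant. *)
Lemma extremal_orthogonal_direction (k j : nat) (A : 'M[R]_N) (D : R)
    (f : nat -> 'rV[R]_N) : N = (k + k)%N -> (j < k)%N ->
  contractive A -> 0 < D -> 7 / 8 * D < `|\det A| ->
  (forall B, contractive B -> `|\det B| <= D) ->
  (forall i i', (i < j)%N -> (i' < j)%N -> (f i *m (f i')^T) 0 0 = (i == i')%:R) ->
  exists g : 'rV[R]_N, [/\ sqn g = 1, forall i, (i < j)%N -> f i *m g^T = 0 &
    4^-1 <= rnorm (comb_row (g *m A))].
Proof.
move=> Nk jk cA D0 dA HD Hf; apply: contrapT => H.
have small t : (forall i, (i < j)%N -> f i *m t^T = 0) ->
    rnorm (comb_row (t *m A)) <= 4^-1 * Num.sqrt (sqn t).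
  move=> Ht; have [/sqn_eq0 ->|t0] := eqVneq (sqn t) 0.
    by rewrite mul0mx comb_row0 rnorm0 mulr_ge0 // sqrtr_ge0.
  have q0 : 0 < Num.sqrt (sqn t) by rewrite sqrtr_gt0 lt_def t0 sqn_ge0.
  rewrite leNgt; apply/negP => lt; apply: H.
  exists ((Num.sqrt (sqn t))^-1 *: t); split.
  - by rewrite sqnZ exprVn sqr_sqrtr ?sqn_ge0 // mulVf.
  - by move=> i /Ht e; rewrite linearZ /= -scalemxAr e scaler0.
  rewrite -scalemxAl comb_rowZ rnormZr ger0_norm ?invr_ge0 ?sqrtr_ge0 //.
  by rewrite mulrC ler_pdivlMr // ltW.
pose F : 'M[R]_(j, N) := \matrix_(i < j) f i.
have FE (i : 'I_j) : row i F = f i by rewrite rowK.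
have FF : F *m F^T = 1%:M.
  apply/matrixP => i i'; rewrite !mxE -val_eqE /= -Hf // mxE.
  by apply: eq_bigr => l _; rewrite !mxE.
pose P : 'M[R]_N := 1%:M - F^T *m F.
have PT : P^T = P by rewrite /P linearB /= trmx1 trmx_mul trmxK.
have FP : F *m P = 0 by rewrite mulmxBr mulmx1 mulmxA FF mul1mx subrr.
have PP : P *m P = P by rewrite {1}/P mulmxBl mul1mx -mulmxA FP mulmx0 subr0.
have sqnP t : sqn (t *m P) <= sqn t.
  have -> : sqn t = sqn (t *m P) + sqn (t *m F^T).
    rewrite /sqn !trmx_mul PT trmxK !mulmxA -(mulmxA t P P) PP.
    rewrite /P mulmxBr mulmx1 mulmxBl mulmxA [X in _ = X + _]mxE.
    by rewrite [X in _ = _ + X + _]mxE subrK.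
  by rewrite lerDl sqn_ge0.
pose B : 'M[R]_N := (4 / 5) *: ((1%:M + P) *m A).
have cB : contractive B.
  move=> t; rewrite -scalemxAr mulmxA mulmxDr mulmx1 mulmxDl comb_rowZ comb_rowD.
  rewrite rnormZr ger0_norm // -[leRHS]sqr_sqrtr ?sqn_ge0 //.
  rewrite ler_pXn2r ?nnegrE ?sqrtr_ge0 ?mulr_ge0 ?rnorm_ge0 //.
  have h1 : rnorm (comb_row (t *m A)) <= Num.sqrt (sqn t).
    rewrite -(ler_pXn2r (n := 2)) ?nnegrE ?sqrtr_ge0 ?rnorm_ge0 //.
    by rewrite sqr_sqrtr ?sqn_ge0.
  have h2 : rnorm (comb_row (t *m P *m A)) <= 4^-1 * Num.sqrt (sqn t).
    rewrite (le_trans (small _ _)) //; last by rewrite ler_wpM2l // ler_sqrt ?sqn_ge0.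
    move=> i ij; rewrite trmx_mul PT mulmxA -(FE (Ordinal ij)) -row_mul FP.
    by rewrite row0 mul0mx.
  have := rnormD (comb_row (t *m A)) (comb_row (t *m P *m A)).
  by move: h1 h2; lra.
have detB : \det B = (4 / 5) ^+ N * (\det (2%:M - F^T *m F) * \det A).
  rewrite detZ det_mulmx; congr (_ * (\det _ * _)).
  by rewrite /P addrA -raddfD.
have powN (r : R) : r ^+ N = r ^+ k * r ^+ k by rewrite Nk exprD.
have dF : 2 ^+ k <= \det (2%:M - F^T *m F).
  have := det_orthonormal_rows FF; rewrite powN => e.
  rewrite -(ler_pM2r (exprn_gt0 j (ltr0n R 2))) e ler_pM2l ?exprn_gt0 //.
  by rewrite ler_eXn2l ?ltr1n // ltnW.
have := HD B cB; apply/negP; rewrite -ltNge detB !normrM.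
have k0 : (0 < k)%N by rewrite (leq_ltn_trans _ jk).
have big : 32 / 25 <= (4 / 5) ^+ N * \det (2%:M - F^T *m F) :> R.
  apply: (@le_trans _ _ ((4 / 5) ^+ N * 2 ^+ k)); last by rewrite ler_wpM2l // exprn_ge0.
  rewrite powN -!exprMn (_ : 4 / 5 * (4 / 5) * 2 = 32 / 25 :> R); last by field.
  rewrite -(prednK k0) exprS ler_peMr ?divr_ge0 // exprn_ege1 //.
  by rewrite ler_pdivlMr // mul1r ler_nat.
rewrite mulrA -normrM (lt_le_trans _ (ler_wpM2r (normr_ge0 _) (le_trans big (ler_norm _)))) //.
by move: dA D0; lra.
Qed.

(** A long orthonormal system on which an almost extremal contraction is
    bounded below. *)
Lemma extremal_orthonormal_system (k : nat) (A : 'M[R]_N) (D : R) :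
  N = (k + k)%N -> contractive A -> 0 < D -> 7 / 8 * D < `|\det A| ->
  (forall B, contractive B -> `|\det B| <= D) ->
  exists f : nat -> 'rV[R]_N,
    (forall i i', (i < k)%N -> (i' < k)%N -> (f i *m (f i')^T) 0 0 = (i == i')%:R) /\
    forall i, (i < k)%N -> 4^-1 <= rnorm (comb_row (f i *m A)).
Proof.
move=> Nk cA D0 dA HD.
suff H j : (j <= k)%N -> exists f : nat -> 'rV[R]_N,
    (forall i i', (i < j)%N -> (i' < j)%N -> (f i *m (f i')^T) 0 0 = (i == i')%:R) /\
    forall i, (i < j)%N -> 4^-1 <= rnorm (comb_row (f i *m A)) by exact: H.
elim: j => [_|j IH jk]; first by exists (fun=> 0).
have [f [f1 f2]] := IH (ltnW jk).
have [g [g1 g2 g3]] := extremal_orthogonal_direction Nk jk cA D0 dA HD f1.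
exists (fun i => if i == j then g else f i); split; last first.
  by move=> i; rewrite ltnS leq_eqVlt; case: eqP => [//|_] /= /f2.
have lt_j i : (i < j.+1)%N -> i != j -> (i < j)%N.
  by rewrite ltnS leq_eqVlt => /orP[->|].
move=> i i' h h'; have [ij|ij] := eqVneq i j; have [ij'|ij'] := eqVneq i' j.
- by rewrite ij ij' eqxx -[LHS]/(sqn g).
- have := g2 _ (lt_j _ h' ij') => /(congr1 trmx); rewrite trmx_mul trmxK trmx0 => ->.
  by rewrite mxE ij eq_sym (negbTE ij').
- by rewrite (g2 _ (lt_j _ h ij)) mxE ij' (negbTE ij).
by apply: f1; exact: lt_j.
Qed.

End DvoretzkyRogers.

(** The Dvoretzky-Rogers lemma: an infinite-dimensional space contains
    arbitrarily long systems of vectors bounded below in norm that satisfy an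
    upper $2$-estimate. *)
Theorem dvoretzky_rogers (R : realType) (s : scalar_kind)
    (Y : normedModType (scalar_field R s)) (k : nat) : infinite_dimensional Y ->
  exists y : nat -> Y, (forall i, (i < k)%N -> 4^-1 <= rnorm (y i)) /\
    forall a : nat -> scalar_field R s,
      rnorm (\sum_(i < k) a i *: y i) ^+ 2 <= 2 * \sum_(i < k) sabs (a i) ^+ 2.
Proof.
move=> infY; have [v [c [c0 Hc]]] := bounded_coordinates_system (k + k) infY.
have [A [D [cA D0 dA HD]]] := contractive_almost_max c0 Hc.
have [f [f1 f2]] := extremal_orthonormal_system erefl cA D0 dA HD.
exists (fun i => comb_row v (f i *m A)); split => // a.
have real (t : nat -> R) :
    rnorm (\sum_(i < k) of_real s (t i) *: comb_row v (f i *m A)) ^+ 2 <=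
    \sum_(i < k) t i ^+ 2.
  pose u : 'rV[R]_k := \row_i t i.
  pose F : 'M[R]_(k, k + k) := \matrix_(i < k) f i.
  have FF : F *m F^T = 1%:M.
    apply/matrixP => i i'; rewrite !mxE -val_eqE /= -f1 // mxE.
    by apply: eq_bigr => l _; rewrite !mxE.
  have -> : \sum_(i < k) of_real s (t i) *: comb_row v (f i *m A) =
      comb_row v ((u *m F) *m A).
    have -> : u *m F = \sum_(i < k) t i *: f i.
      rewrite mulmx_sum_row; apply: eq_bigr => i _.
      by rewrite mxE rowK.
    rewrite mulmx_suml (big_morph (comb_row v) (@comb_rowD _ _ _ _ v) (@comb_row0 _ _ _ _ v)).
    by apply: eq_bigr => i _; rewrite -scalemxAl comb_rowZ.
  rewrite (le_trans (cA _)) // /sqn trmx_mul !mulmxA -(mulmxA u) FF mulmx1.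
  rewrite -/(sqn u) sqnE le_eqVlt; apply/orP; left; apply/eqP.
  by apply: eq_bigr => i _; rewrite mxE.
(* split the coefficients into real and imaginary parts *)
have [u Hu] := choice (fun i => scalar_decomp (a i)).
have [w Hw] := choice Hu.
have -> : \sum_(i < k) a i *: comb_row v (f i *m A) =
    \sum_(i < k) of_real s (u i) *: comb_row v (f i *m A) +
    iunit R s *: \sum_(i < k) of_real s (w i) *: comb_row v (f i *m A).
  rewrite scaler_sumr -big_split; apply: eq_bigr => i _ /=.
  by rewrite {1}(proj1 (Hw i)) scalerDl scalerA.
have -> : \sum_(i < k) sabs (a i) ^+ 2 =
    \sum_(i < k) u i ^+ 2 + \sum_(i < k) w i ^+ 2.
  by rewrite -big_split; apply: eq_bigr => i _; rewrite (proj2 (Hw i)).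
move: (real u) (real w).
set q := \sum_(i < k) of_real s (u i) *: _; set p := \sum_(i < k) of_real s (w i) *: _.
move=> hq hp.
have h : rnorm (q + iunit R s *: p) <= rnorm q + rnorm p.
  rewrite (le_trans (rnormD _ _)) // lerD2l rnormZs ler_piMl ?rnorm_ge0 //.
  exact: sabs_iunit.
have h2 : rnorm (q + iunit R s *: p) ^+ 2 <= (rnorm q + rnorm p) ^+ 2.
  by rewrite ler_pXn2r ?nnegrE ?addr_ge0 ?rnorm_ge0.
have h3 := sqr_ge0 (rnorm q - rnorm p).
move: hp hq h2 h3; rewrite sqrrD sqrrB; lra.
Qed.

(** * The coordinates in the basis are absolutely summable *)

Section L1Coordinates.
Variables (R : realType) (s : scalar_kind).
Local Notation K := (scalar_field R s).
Variables (X : completeNormedModType K) (Y : normedModType K) (e : nat -> X).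
Hypothesis He : unconditional_basis e.
Hypothesis infY : infinite_dimensional Y.
Variables (Cu k : R).
Hypothesis Cu0 : 0 <= Cu.
Hypothesis HCu : forall x, unorm He x <= Cu * rnorm x.
Hypothesis k0 : 0 <= k.
Hypothesis Hk : forall (u : X -> Y) (B : R), 0 <= B -> bounded_linear u B ->
  summing u (k * B).

(** Unconditionality bounds the weak $\ell_1$-norm of the terms of an expansion. *)
Lemma weak_l1_expansion n x :
  weak_l1_le [seq bcoef He x i *: e i | i : 'I_n <- index_enum 'I_n] (4 * unorm He x).
Proof.
move=> phi [lphi Hphi]; rewrite big_map; apply: sum_sabs_le => P.
rewrite -(linear_sum_fun _ _ _ lphi) (le_trans (Hphi _)) // mul1r.
set S := (X in rnorm X); pose Q i := if insub i is Some i then P i else false.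
rewrite (_ : S = psum He n Q x) ?unorm_ub // /S /psum; apply: eq_bigl => i.
by rewrite /Q valK.
Qed.

(** The partial sums of the $\ell_1$-norm of the normalized coordinates. *)
Definition l1sum n x : R := \sum_(i < n) sabs (bcoef He x i) * rnorm (e i).

Lemma l1sum_ge0 n x : 0 <= l1sum n x.
Proof. by apply: sumr_ge0 => i _; rewrite mulr_ge0 ?sabs_ge0 ?rnorm_ge0. Qed.

Lemma l1sumZ n (r : R) x : l1sum n (of_real s r *: x) = `|r| * l1sum n x.
Proof.
rewrite /l1sum mulr_sumr; apply: eq_bigr => i _.
by rewrite bcoefZ sabsM sabs_of_real mulrA.
Qed.

(** A bound $N$ for [l1sum] improves to a multiple of $\sqrt N$: the operator that
    sends the normalized basis to a Dvoretzky-Rogers system has norm of order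
    $\sqrt N$, because the normalized coordinates satisfy
    $\sum_i |b_i|^2 \le \max_i |b_i| \sum_i |b_i|$, and the norms of the images of the
    terms of the expansion add up to at least $\frac14 \sum_i |b_i|$. *)
Lemma l1sum_improve n (N : R) : 0 <= N ->
  (forall x, l1sum n x <= N * rnorm x) ->
  forall x, l1sum n x <= 16 * k * Cu * Num.sqrt (2 * Cu * N) * rnorm x.
Proof.
move=> N0 HN x; have [y [y1 y2]] := @dvoretzky_rogers R s Y n infY.
pose u z : Y := \sum_(i < n) (bcoef He z i * of_real s (rnorm (e i))) *: y i.
have lu : linear u.
  move=> a z w; rewrite /u scaler_sumr -big_split; apply: eq_bigr => i _ /=.
  by rewrite bcoefZD scalerA -scalerDl mulrDl mulrA.
set q := Num.sqrt _; have q0 : 0 <= q by exact: sqrtr_ge0.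
have Hu : bounded_linear u q.
  split => // z; rewrite -(ler_pXn2r (n := 2)) ?nnegrE ?mulr_ge0 ?rnorm_ge0 //.
  rewrite exprMn sqr_sqrtr ?mulr_ge0 //.
  apply: le_trans (y2 (fun i => bcoef He z i * of_real s (rnorm (e i)))) _.
  rewrite -!mulrA ler_wpM2l //.
  apply: (@le_trans _ _ (\sum_(i < n) Cu * rnorm z * (sabs (bcoef He z i) * rnorm (e i)))).
    apply: ler_sum => i _; rewrite sabsM sabs_of_real ger0_norm ?rnorm_ge0 // expr2.
    rewrite ler_wpM2r ?mulr_ge0 ?sabs_ge0 ?rnorm_ge0 //.
    exact: le_trans (unorm_bcoef He z i) (HCu z).
  rewrite -mulr_sumr expr2 -!mulrA ler_wpM2l // mulrCA.
  by rewrite ler_wpM2l ?rnorm_ge0 // HN.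
have := Hk q0 Hu (@weak_l1_expansion n x); rewrite big_map => h.
have low : 4^-1 * l1sum n x <= \sum_(i < n) rnorm (u (bcoef He x i *: e i)).
  rewrite /l1sum mulr_sumr; apply: ler_sum => i _.
  have -> : u (bcoef He x i *: e i) = (bcoef He x i * of_real s (rnorm (e i))) *: y i.
    rewrite /u (bigD1 i) //= bcoefZ bcoef_basis eqxx mulr1 big1 ?addr0 // => j ji.
    rewrite bcoefZ bcoef_basis (_ : (j == i :> nat) = false) ?mulr0 ?mul0r ?scale0r //.
    exact/negbTE.
  rewrite rnormZs sabsM sabs_of_real ger0_norm ?rnorm_ge0 // mulrC.
  by rewrite ler_wpM2l ?mulr_ge0 ?sabs_ge0 ?rnorm_ge0 // y1.
have h2 : k * q * (4 * unorm He x) <= k * q * (4 * (Cu * rnorm x)).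
  by rewrite ler_wpM2l ?mulr_ge0 // ler_wpM2l.
have -> : 16 * k * Cu * q * rnorm x = 4 * (k * q * (4 * (Cu * rnorm x))) by ring.
by rewrite -ler_pdivrMl // (le_trans low) // (le_trans h).
Qed.

(** The optimal bound $N$ is finite for every $n$ and satisfies $N \le L \sqrt N$. *)
Lemma l1sum_bounded n x :
  l1sum n x <= (16 * k * Cu * Num.sqrt (2 * Cu)) ^+ 2 * rnorm x.
Proof.
pose S := [set l1sum n x | x in [set x : X | rnorm x <= 1]].
have hs : has_sup S.
  split; first by exists (l1sum n 0), 0 => //=; rewrite rnorm0.
  exists (\sum_(i < n) Cu) => _ [z /= z1 <-]; apply: ler_sum => i _.
  by rewrite (le_trans (unorm_bcoef _ _ _)) // (le_trans (HCu z)) // ler_piMr.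
have S0 : 0 <= sup S.
  rewrite (le_trans (l1sum_ge0 n 0)) //; apply: sup_upper_bound => //.
  by exists 0 => //=; rewrite rnorm0.
have HS z : l1sum n z <= sup S * rnorm z.
  have [->|z0] := eqVneq z 0.
    rewrite rnorm0 mulr0 -(scaler0 _ (of_real s 0)) l1sumZ normr0 mul0r //.
  have nz := rnorm_gt0 z0; rewrite -ler_pdivrMr // mulrC.
  rewrite -[(rnorm z)^-1]ger0_norm ?invr_ge0 ?rnorm_ge0 // -l1sumZ.
  apply: sup_upper_bound => //; exists (of_real s (rnorm z)^-1 *: z) => //=.
  by rewrite rnormZr ger0_norm ?invr_ge0 ?rnorm_ge0 // mulVf // gt_eqF.
pose L := 16 * k * Cu * Num.sqrt (2 * Cu).
have L0 : 0 <= L by rewrite !mulr_ge0 ?sqrtr_ge0.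
have SL : sup S <= L * Num.sqrt (sup S).
  apply: ge_sup; first by case: hs.
  move=> _ [z /= z1 <-]; rewrite (le_trans (l1sum_improve S0 HS z)) //.
  rewrite sqrtrM ?mulr_ge0 // mulrA -/L ler_piMr // mulr_ge0 // sqrtr_ge0.
have {}SL : sup S <= L ^+ 2.
  have [S00|S1] := eqVneq (sup S) 0; first by rewrite S00 sqr_ge0.
  have q0 : 0 < Num.sqrt (sup S) by rewrite sqrtr_gt0 lt_def S1.
  have SE : sup S = Num.sqrt (sup S) ^+ 2 by rewrite sqr_sqrtr.
  move: SL; rewrite {1}SE expr2 ler_pM2r // => h.
  by rewrite SE ler_pXn2r ?nnegrE ?sqrtr_ge0.
by rewrite (le_trans (HS x)) // ler_wpM2r ?rnorm_ge0.
Qed.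

End L1Coordinates.

(** * The isomorphism with the space of absolutely summable sequences *)

Section IsomorphismL1.
Variables (R : realType) (s : scalar_kind).
Local Notation K := (scalar_field R s).
Variables (X : completeNormedModType K) (e : nat -> X).
Hypothesis He : unconditional_basis e.
Variable C : R.
Hypothesis HC : forall n x, l1sum He n x <= C * rnorm x.

Lemma rnorm_l1 (a : l1 R s) : rnorm a = limn (series (fun n => rnorm (a n))).
Proof. exact: of_realK. Qed.

Lemma l1_partial_le (a : l1 R s) n : \sum_(k < n) rnorm (a k) <= rnorm a.
Proof.
rewrite rnorm_l1; have := @l1_cvg R s a; set u := series _ => cu.
have -> : \sum_(k < n) rnorm (a k) = u n by rewrite /u seriesE.
apply: nondecreasing_cvgn_le => //; apply/nondecreasing_seqP => j.
by rewrite /u seriesSr lerDl rnorm_ge0.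
Qed.

Lemma l1_norm_le (a : l1 R s) B : (forall n, \sum_(k < n) rnorm (a k) <= B) ->
  rnorm a <= B.
Proof.
move=> H; rewrite rnorm_l1; apply: limr_le; first exact: (@l1_cvg R s a).
by apply: nearW => n; rewrite seriesE.
Qed.

(** The sequence of normalized coordinates of [x]. *)
Definition to_l1_seq (x : X) : nat -> K^o :=
  fun n => bcoef He x n * of_real s (rnorm (e n)).

Lemma to_l1_seq_partial x n : \sum_(k < n) rnorm (to_l1_seq x k) = l1sum He n x.
Proof.
apply: eq_bigr => k _; rewrite -[LHS]/(sabs (_ * _)) sabsM sabs_of_real.
by rewrite ger0_norm ?rnorm_ge0.
Qed.

Lemma to_l1_subproof x : to_l1_seq x \in @summable_seq R s.
Proof.
apply/asboolP; apply: nondecreasing_is_cvgn.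
  by apply/nondecreasing_seqP => n; rewrite seriesSr lerDl rnorm_ge0.
exists (C * rnorm x) => _ [n _ <-].
by rewrite seriesE to_l1_seq_partial.
Qed.

Definition to_l1 (x : X) : l1 R s := L1 (to_l1_subproof x).

Lemma to_l1_linear : linear to_l1.
Proof.
move=> a x y; apply: val_inj; apply/funext => n /=.
by rewrite /to_l1_seq bcoefZD mulrDl -mulrA.
Qed.

Lemma to_l1_bounded : bounded_linear to_l1 C.
Proof.
split; first exact: to_l1_linear.
by move=> x; apply: l1_norm_le => n; rewrite to_l1_seq_partial.
Qed.

Lemma of_l1_exists (a : l1 R s) : exists x, rnorm x <= rnorm a /\
  rcvg (fun n => \sum_(k < n) (a k / of_real s (rnorm (e k))) *: e k) x.
Proof.
have nz k : `|(rnorm (e k))^-1| * rnorm (e k) = 1.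
  rewrite ger0_norm ?invr_ge0 ?rnorm_ge0 // mulVf // gt_eqF //.
  by rewrite rnorm_gt0 // (basis_neq0 He).
have [||x Hx Hx'] := rcomplete_tele (rcomplete (V := X))
    (w := fun n => \sum_(k < n) (a k / of_real s (rnorm (e k))) *: e k)
    (c := fun k => rnorm (a k)) (B := rnorm a).
- move=> n; rewrite big_ord_recr /= addrAC subrr add0r rnormZs sabsM -of_realV.
  by rewrite sabs_of_real -mulrA nz mulr1.
- exact: l1_partial_le.
by exists x; split => //; have := Hx' 0%N; rewrite !big_ord0 !subr0.
Qed.

Definition of_l1 (a : l1 R s) : X := projT1 (cid (of_l1_exists a)).

Lemma of_l1P (a : l1 R s) : rnorm (of_l1 a) <= rnorm a /\
  rcvg (fun n => \sum_(k < n) (a k / of_real s (rnorm (e k))) *: e k) (of_l1 a).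
Proof. by rewrite /of_l1; case: cid. Qed.

Lemma of_l1_linear : linear of_l1.
Proof.
move=> c a b; apply: (rcvg_unique (proj2 (of_l1P _))).
apply: (@rcvg_ext _ _ _ (fun n =>
  c *: (\sum_(k < n) (a k / of_real s (rnorm (e k))) *: e k) +
  \sum_(k < n) (b k / of_real s (rnorm (e k))) *: e k)).
  move=> n; rewrite scaler_sumr -big_split; apply: eq_bigr => k _ /=.
  by rewrite scalerA -scalerDl mulrA -mulrDl.
by apply: rcvgD; [apply: rcvgZ; exact: (proj2 (of_l1P _)) | exact: (proj2 (of_l1P _))].
Qed.

Lemma of_l1_bounded : bounded_linear of_l1 1.
Proof.
by split; [exact: of_l1_linear | move=> a; rewrite mul1r (proj1 (of_l1P _))].
Qed.

Lemma to_l1K : cancel to_l1 of_l1.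
Proof.
move=> x; apply: (rcvg_unique (proj2 (of_l1P _))).
apply: (@rcvg_ext _ _ _ (fun n => \sum_(k < n) bcoef He x k *: e k)); last exact: bcoefP.
move=> n; apply: eq_bigr => k _; rewrite /= /to_l1_seq mulfK // of_real_eq0.
by rewrite gt_eqF // rnorm_gt0 // (basis_neq0 He).
Qed.

Lemma of_l1K : cancel of_l1 to_l1.
Proof.
move=> a; apply: val_inj; apply/funext => n /=.
have E := @bcoef_unique _ _ _ _ He _ (fun k => a k / of_real s (rnorm (e k))) (proj2 (of_l1P a)).
rewrite /to_l1_seq E divfK // of_real_eq0.
by rewrite gt_eqF // rnorm_gt0 // (basis_neq0 He).
Qed.

Theorem isomorphic_l1 : isomorphic X (l1 R s).
Proof.
pose f : {linear X -> l1 R s} :=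
  HB.pack to_l1 (GRing.isLinear.Build _ _ _ _ to_l1 to_l1_linear).
pose g : {linear l1 R s -> X} :=
  HB.pack of_l1 (GRing.isLinear.Build _ _ _ _ of_l1 of_l1_linear).
exists f, g; split.
- exact: to_l1K.
- exact: of_l1K.
- exact: (bounded_operator_continuous to_l1_bounded).
- exact: (bounded_operator_continuous of_l1_bounded).
Qed.

End IsomorphismL1.

(** * A two-summing inequality for contraction matrices *)

(** The matrix [a] induces a contraction between the Euclidean spaces over $I$
    and $J$. *)
Definition l2_contraction (R : realType) (s : scalar_kind) (I J : finType)
    (a : J -> I -> scalar_field R s) :=
  forall t : I -> scalar_field R s,
    \sum_j sabs (\sum_i a j i * t i) ^+ 2 <= \sum_i sabs (t i) ^+ 2.

Section ContractionInequality.
Variables (R : realType) (s : scalar_kind).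
Local Notation K := (scalar_field R s).
Variables (X : completeNormedModType K) (Y : normedModType K) (e : nat -> X).
Hypothesis He : unconditional_basis e.
Variables (C k : R).
Hypothesis C0 : 0 <= C.
Hypothesis HC : forall n x, l1sum He n x <= C * rnorm x.
Hypothesis k0 : 0 <= k.
Hypothesis Hk : forall (u : X -> Y) (B : R), 0 <= B -> bounded_linear u B ->
  summing u (k * B).

(** The operator $u$ that sends the normalized basis vectors to the normalized
    vectors $y_i$ is $2$-summing; apply this to the vectors
    $x_j = \sum_i a_{ji} \|y_i\| e_i$, where the basis is taken normalized. That an
    absolutely summing operator is $2$-summing follows by weighting each $x_j$
    with $z_j = \|u x_j\|$. *)
Theorem l2_contraction_inequality (I J : finType) (a : J -> I -> K) (y : I -> Y) :
  l2_contraction a ->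
  \sum_j rnorm (\sum_i a j i *: y i) ^+ 2 <= (k * C) ^+ 2 * \sum_i rnorm (y i) ^+ 2.
Proof.
move=> Ha; pose r (i : I) : nat := enum_rank i.
have rI i i' : (r i == r i') = (i == i').
  by rewrite /r (inj_eq val_inj) (inj_eq enum_rank_inj).
pose eps i := rnorm (e (r i)); pose rho i := rnorm (y i).
have eps0 i : 0 < eps i by rewrite rnorm_gt0 // (basis_neq0 He).
have rho0 i : 0 <= rho i by exact: rnorm_ge0.
pose u x : Y := \sum_i (bcoef He x (r i) * of_real s (eps i / rho i)) *: y i.
have lu : linear u.
  move=> c x z; rewrite /u scaler_sumr -big_split; apply: eq_bigr => i _ /=.
  by rewrite bcoefZD scalerA -scalerDl mulrDl mulrA.
have Hu : bounded_linear u C.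
  split => // x; rewrite (le_trans _ (HC #|I| x)) // (le_trans (rnorm_sum _ _ _)) //.
  rewrite /l1sum (reindex (@enum_rank I)) /=; last first.
    by exists enum_val => i _; rewrite ?enum_rankK ?enum_valK.
  apply: ler_sum => i _; rewrite rnormZs sabsM -mulrA ler_wpM2l ?sabs_ge0 //.
  rewrite sabs_of_real ger0_norm ?divr_ge0 ?rho0 ?(ltW (eps0 i)) // -mulrA.
  rewrite ler_piMr ?(ltW (eps0 i)) // -/(rho i).
  by have [->|h] := eqVneq (rho i) 0; rewrite ?mulr0 // mulVf.
pose x j := \sum_i (a j i * of_real s (rho i / eps i)) *: e (r i).
have ux j : u (x j) = \sum_i a j i *: y i.
  rewrite /x (linear_sum_fun _ _ _ lu); apply: eq_bigr => i _.
  rewrite linearZ_fun // {1}/u (bigD1 i) //= bcoef_basis eqxx mul1r big1 ?addr0; last first.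
    by move=> i' i'i; rewrite bcoef_basis rI (negbTE i'i) mul0r scale0r.
  have [yi|yi] := eqVneq (y i) 0; first by rewrite yi !scaler0.
  rewrite scalerA -mulrA -of_realM mulrA divfK ?gt_eqF // divff ?of_real1 ?mulr1 //.
  by rewrite gt_eqF // /rho rnorm_gt0.
pose z j := rnorm (u (x j)).
rewrite (eq_bigr (fun j => z j ^+ 2)); last by move=> j _; rewrite /z ux.
set Z := \sum_j z j ^+ 2; set S := \sum_i _; pose L := k * C.
have L0 : 0 <= L by rewrite mulr_ge0.
(* the parameter replaces the Cauchy-Schwarz inequality; it is $1 / L$ below *)
have key (tau : R) : 0 < tau -> Z <= L * ((tau * Z + S / tau) / 2).
  move=> tau0.
  have := @Hk u C C0 Hu [seq of_real s (z j) *: x j | j <- index_enum J]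
    ((tau * Z + S / tau) / 2).
  rewrite big_map (eq_bigr (fun j => z j ^+ 2)); last first.
    move=> j _; rewrite linearZ_fun // rnormZr ger0_norm ?rnorm_ge0 //.
  apply; move=> phi [lphi Hphi]; rewrite big_map.
  have wS : \sum_j sabs (phi (x j)) ^+ 2 <= S.
    pose t i : K := of_real s (rho i / eps i) * phi (e (r i)).
    rewrite (eq_bigr (fun j => sabs (\sum_i a j i * t i) ^+ 2)).
      rewrite (le_trans (Ha t)) //; apply: ler_sum => i _.
      rewrite ler_pXn2r ?nnegrE ?sabs_ge0 ?rho0 // /t sabsM sabs_of_real.
      rewrite ger0_norm ?divr_ge0 ?rho0 ?(ltW (eps0 i)) // -mulrA ler_piMr //.
      by rewrite ler_pdivrMl // mulr1 (le_trans (Hphi _)) // mul1r.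
    move=> j _; congr (sabs _ ^+ 2); rewrite /x (linear_sum_fun _ _ _ lphi).
    by apply: eq_bigr => i _; rewrite linearZ_fun // /t mulrA.
  apply: (@le_trans _ _ (\sum_j (tau * z j ^+ 2 + sabs (phi (x j)) ^+ 2 / tau) / 2)).
    apply: ler_sum => j _; rewrite linearZ_fun //.
    rewrite [sabs _](_ : _ = z j * sabs (phi (x j))); last first.
      by rewrite -[LHS]/(sabs (_ * _)) sabsM sabs_of_real ger0_norm ?rnorm_ge0.
    set w := sabs _.
    have -> : (tau * z j ^+ 2 + w ^+ 2 / tau) / 2 =
        z j * w + (tau * z j - w) ^+ 2 / (2 * tau) by field; rewrite gt_eqF.
    by rewrite lerDl divr_ge0 ?sqr_ge0 // mulr_ge0 // ltW.
  rewrite -mulr_suml big_split -mulr_sumr -mulr_suml /= ler_pM2r ?invr_gt0 //.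
  by rewrite lerD2l ler_pM2r // invr_gt0.
have [L00|Lne] := eqVneq L 0.
  rewrite -/L L00 expr0n mul0r (le_trans (key 1 ltr01)) // L00 mul0r //.
have Lp : 0 < L by rewrite lt_def Lne.
have := key L^-1; rewrite invr_gt0 invrK => /(_ Lp).
have -> : L * ((L^-1 * Z + S * L) / 2) = (Z + L ^+ 2 * S) / 2 by field.
rewrite -/L; lra.
Qed.

End ContractionInequality.

(** * An equivalent quadratic form *)

Section HilbertianNorm.
Variables (R : realType) (s : scalar_kind).
Local Notation K := (scalar_field R s).
Variables (Y : normedModType K) (M : R).
Hypothesis M0 : 0 <= M.
Hypothesis HM : forall (I J : finType) (a : J -> I -> K) (y : I -> Y), l2_contraction a ->
  \sum_j rnorm (\sum_i a j i *: y i) ^+ 2 <= M * \sum_i rnorm (y i) ^+ 2.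

(** The $2$-homogeneous functions $q \le M \|\cdot\|^2$ for which
    $\sum_j \|z_j\|^2 \le \sum_i q(y_i)$ whenever the family $z$ is the image of
    the family $y$ under a contraction matrix. The minimal ones turn out to be
    squares of Hilbert norms. *)
Definition majorant (q : Y -> R) : Prop :=
  [/\ forall y, 0 <= q y, forall y, q y <= M * rnorm y ^+ 2,
      forall (c : K) y, q (c *: y) = sabs c ^+ 2 * q y &
      forall (I J : finType) (a : J -> I -> K) (y : I -> Y), l2_contraction a ->
        \sum_j rnorm (\sum_i a j i *: y i) ^+ 2 <= \sum_i q (y i)].

Lemma majorant_norm : majorant (fun y => M * rnorm y ^+ 2).
Proof.
split=> //.
- by move=> y; rewrite mulr_ge0 // sqr_ge0.
- by move=> c y; rewrite rnormZs exprMn mulrCA.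
by move=> I J a y Ha; rewrite -mulr_sumr; exact: HM.
Qed.

Section ChainInfimum.
Variable A : set {q : Y -> R | majorant q}.
Hypothesis A_neq0 : A !=set0.
Hypothesis A_total : forall p q, A p -> A q ->
  (forall y, sval p y <= sval q y) \/ (forall y, sval q y <= sval p y).

(** The pointwise infimum of a chain of majorants. *)
Definition chain_inf (y : Y) : R := inf [set sval q y | q in A].

Lemma chain_has_inf y : has_inf [set sval q y | q in A].
Proof.
case: A_neq0 => q Aq; split; first by exists (sval q y), q.
by exists 0 => _ [p _ <-]; case: (proj2_sig p).
Qed.

Lemma chain_inf_le q y : A q -> chain_inf y <= sval q y.
Proof. by move=> Aq; apply: ge_inf; [case: (chain_has_inf y) | exists q]. Qed.

Lemma chain_inf_ge y B : (forall q, A q -> B <= sval q y) -> B <= chain_inf y.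
Proof.
move=> H; apply: lb_le_inf; first by case: (chain_has_inf y).
by move=> _ [q Aq <-]; exact: H.
Qed.

(** Finitely many values of the infimum are almost attained by one element. *)
Lemma chain_inf_adherent (I : eqType) (r : seq I) (y : I -> Y) (d : R) : 0 < d ->
  exists2 q, A q & forall i, i \in r -> sval q (y i) <= chain_inf (y i) + d.
Proof.
move=> d0; elim: r => [|i r [q Aq Hq]]; first by case: A_neq0 => q Aq; exists q.
have [_ [p Ap <-] Hp] := inf_adherent d0 (chain_has_inf (y i)).
have [pq|qp] := A_total Ap Aq.
  exists p => // j; rewrite inE => /predU1P[->|/Hq]; first exact: ltW.
  exact: le_trans.
exists q => // j; rewrite inE => /predU1P[->|/Hq //].
by rewrite (le_trans (qp _)) // ltW.
Qed.

Lemma majorant_chain_inf : majorant chain_inf.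
Proof.
have inf0 y : 0 <= chain_inf y.
  by apply: chain_inf_ge => q _; case: (proj2_sig q).
split => //.
- move=> y; case: A_neq0 => q Aq; rewrite (le_trans (chain_inf_le y Aq)) //.
  by case: (proj2_sig q).
- have le (c : K) y : sabs c ^+ 2 * chain_inf y <= chain_inf (c *: y).
    apply: chain_inf_ge => q Aq; case: (proj2_sig q) => _ _ -> _.
    by rewrite ler_wpM2l ?sqr_ge0 // chain_inf_le.
  move=> c y; apply/eqP; rewrite eq_le le andbT.
  have [->|c0] := eqVneq c 0.
    case: A_neq0 => q Aq; rewrite sabs0 expr0n mul0r (le_trans (chain_inf_le _ Aq)) //.
    by case: (proj2_sig q) => _ _ -> _; rewrite sabs0 expr0n mul0r.
  have := le c^-1 (c *: y); rewrite scalerA mulVf // scale1r sabsV exprVn.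
  by rewrite ler_pdivrMl // exprn_gt0 // sabs_gt0.
move=> I J a y Ha; apply/ler_addgt0Pr => d d0.
have d1 : 0 < d / #|I|.+1%:R by rewrite divr_gt0.
have [q Aq Hq] := chain_inf_adherent (index_enum I) y d1.
case: (proj2_sig q) => _ _ _ /(_ I J a y Ha) /le_trans; apply.
apply: (@le_trans _ _ (\sum_i (chain_inf (y i) + d / #|I|.+1%:R))).
  by apply: ler_sum => i _; rewrite Hq // mem_index_enum.
rewrite big_split /= lerD2l sumr_const -[_ *+ _]mulr_natl mulrCA ler_piMr ?(ltW d0) //.
by rewrite ler_pdivrMr // mul1r ler_nat.
Qed.

End ChainInfimum.

Lemma minimal_majorant : exists2 q, majorant q &
  forall p, majorant p -> (forall y, p y <= q y) -> p = q.
Proof.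
pose T := {q : Y -> R | majorant q}.
pose r (p q : T) : bool := `[< forall y, sval q y <= sval p y >].
have [||||q Hq] := @Zorn T r.
- by move=> q; apply/asboolP.
- move=> p q t /asboolP h1 /asboolP h2; apply/asboolP => y.
  exact: le_trans (h2 y) (h1 y).
- move=> [p Hp] [q Hq] /asboolP h1 /asboolP h2; apply: eq_exist; apply/funext => y.
  by apply/eqP; rewrite eq_le; apply/andP; split; [exact: h2 | exact: h1].
- move=> A tA; have [A0|/set0P A0] := eqVneq A set0.
    by exists (exist _ _ majorant_norm) => q; rewrite A0.
  have tA' p q : A p -> A q ->
      (forall y, sval p y <= sval q y) \/ (forall y, sval q y <= sval p y).
    by move=> Ap Aq; have [/asboolP|/asboolP] := tA p q Ap Aq; [right | left].
  exists (exist _ _ (majorant_chain_inf A0 tA')) => q Aq; apply/asboolP => y /=.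
  exact: chain_inf_le.
exists (sval q); first exact: (proj2_sig q).
move=> p Hp pq; have := Hq (exist _ p Hp).
move=> /(_ _)/(congr1 sval) /= -> //; exact/asboolP.
Qed.

Section Minimal.
Variable q : Y -> R.
Hypothesis Hq : majorant q.
Hypothesis q_min : forall p, majorant p -> (forall y, p y <= q y) -> p = q.

(** The function [q] lowered by [d] at [y0], and accordingly at its multiples. *)
Definition lowered (y0 : Y) (d : R) (y : Y) : R :=
  if pselect (exists c, y = c *: y0) is left H
  then sabs (projT1 (cid H)) ^+ 2 * (q y0 - d) else q y.

Lemma lowered_mult y0 d (c : K) : y0 != 0 ->
  lowered y0 d (c *: y0) = sabs c ^+ 2 * (q y0 - d).
Proof.
move=> y00; rewrite /lowered; case: pselect => [H|H]; last by case: H; exists c.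
case: cid => c' /= /eqP; rewrite -subr_eq0 -scalerBl scaler_eq0 (negbTE y00) orbF.
by rewrite subr_eq0 => /eqP ->.
Qed.

Lemma lowered_other y0 d y : (forall c : K, y <> c *: y0) -> lowered y0 d y = q y.
Proof. by move=> H; rewrite /lowered; case: pselect => // h; exfalso; case: h => c /H. Qed.

(** By minimality, $q$ cannot be lowered at $y_0$, so that some instance of the
    majorant inequality in which $y_0$ occurs is almost an equality. *)
Lemma minimal_almost_tight (y0 : Y) (d : R) : 0 < d ->
  exists (I J : finType) (a0 : J -> K) (a : J -> I -> K) (y : I -> Y),
    (forall (t0 : K) (t : I -> K),
       \sum_j sabs (a0 j * t0 + \sum_i a j i * t i) ^+ 2 <=
       sabs t0 ^+ 2 + \sum_i sabs (t i) ^+ 2) /\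
    q y0 - d + \sum_i q (y i) <
      \sum_j rnorm (a0 j *: y0 + \sum_i a j i *: y i) ^+ 2.
Proof.
move=> d0; have [q0 qM qZ qP] := Hq.
have [yd|yd] := ltP (q y0) d.
  exists void, void, (fun=> 0), (fun _ _ => 0), (fun=> 0); split.
    move=> t0 t; rewrite big1 => [|[]//].
    by rewrite addr_ge0 ?sqr_ge0 // sumr_ge0 // => i _; exact: sqr_ge0.
  by rewrite big1 => [|[]//]; rewrite big1 => [|[]//]; rewrite addr0 subr_lt0.
have y00 : y0 != 0.
  apply: contraTneq yd => ->; rewrite -ltNge -(scaler0 _ (0 : K)) qZ sabs0.
  by rewrite expr0n mul0r.
pose p := lowered y0 d.
have pq y : p y <= q y.
  have [[c ->]|H] := pselect (exists c : K, y = c *: y0).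
    by rewrite /p lowered_mult // qZ ler_wpM2l ?sqr_ge0 // gerBl ltW.
  by rewrite /p lowered_other // => c e; apply: H; exists c.
have : ~ majorant p.
  move=> /q_min /(_ pq) /(congr1 (fun f => f y0)).
  rewrite -{1}[y0]scale1r /p lowered_mult // sabs1 expr1n mul1r => /eqP.
  by rewrite -subr_eq0 addrAC subrr sub0r oppr_eq0 gt_eqF.
move=> nmaj.
have [I [J [a [y [Ha lt]]]]] : exists (I J : finType) (a : J -> I -> K) (y : I -> Y),
    l2_contraction a /\ \sum_i p (y i) < \sum_j rnorm (\sum_i a j i *: y i) ^+ 2.
  apply: contrapT => H; apply: nmaj; split.
  - move=> y; have [[c ->]|H'] := pselect (exists c : K, y = c *: y0).
      by rewrite /p lowered_mult // mulr_ge0 ?sqr_ge0 // subr_ge0.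
    by rewrite /p lowered_other // => c e; apply: H'; exists c.
  - by move=> y; rewrite (le_trans (pq y)).
  - move=> c y; have [[b ->]|H'] := pselect (exists b : K, y = b *: y0).
      by rewrite scalerA /p !lowered_mult // sabsM exprMn mulrA.
    have [->|c0] := eqVneq c 0.
      by rewrite scale0r -(scale0r y0) /p lowered_mult // sabs0 expr0n !mul0r.
    rewrite /p !lowered_other // => b e; apply: H'.
      by exists b.
    by exists (c^-1 * b); rewrite -scalerA -e scalerA mulVf // scale1r.
  move=> I J a y Ha; rewrite leNgt; apply/negP => lt; apply: H.
  by exists I, J, a, y.
pose A i := `[< exists c : K, y i = c *: y0 >].
have [c Hc] : {c : I -> K & forall i, if A i then y i = c i *: y0 else c i = 0}.
  apply: (@choice _ _ (fun i c => if A i then y i = c *: y0 else c = 0)) => i.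
  by rewrite /A; case: asboolP => [[c ->]|_]; [exists c | exists 0].
(* the multiples of $y_0$ are merged into one vector, which is normalized *)
pose S := \sum_i sabs (c i) ^+ 2.
have pA i : A i -> p (y i) = sabs (c i) ^+ 2 * (q y0 - d).
  by move=> Ai; have := Hc i; rewrite Ai => ->; rewrite /p lowered_mult.
have pNA i : ~~ A i -> p (y i) = q (y i).
  by move=> /asboolP Ai; rewrite /p lowered_other // => b e; apply: Ai; exists b.
have cNA i : ~~ A i -> c i = 0.
  by move=> /negbTE Ai; have := Hc i; rewrite Ai.
have S0 : 0 < S.
  have S0 : 0 <= S by apply: sumr_ge0 => i _; exact: sqr_ge0.
  rewrite lt_def S0 andbT; apply: contraTneq lt => /eqP.
  rewrite psumr_eq0 => [/allP h|i _]; last exact: sqr_ge0.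
  rewrite -leNgt (le_trans (qP I J a y Ha)) // le_eqVlt; apply/orP; left; apply/eqP.
  apply: eq_bigr => i _; case: (boolP (A i)) => Ai; last by rewrite pNA.
  have := h i (mem_index_enum _); rewrite sqrf_eq0 => /eqP/sabs0_eq0 ci.
  have := Hc i; rewrite Ai (pA i Ai) ci scale0r sabs0 expr0n mul0r => ->.
  by rewrite -(scale0r y0) qZ sabs0 expr0n mul0r.
pose g : K := of_real s (Num.sqrt S)^-1.
have g2 : sabs g ^+ 2 = S^-1.
  rewrite sabs_of_real ger0_norm ?invr_ge0 ?sqrtr_ge0 // exprVn.
  by rewrite sqr_sqrtr // ltW.
have gr : g * of_real s (Num.sqrt S) = 1.
  by rewrite -of_realM mulVf ?of_real1 // gt_eqF // sqrtr_gt0.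
pose a0 j := g * \sum_i a j i * c i.
pose a1 j i := if A i then 0 else a j i.
pose y1 i := if A i then 0 else g *: y i.
exists I, J, a0, a1, y1; split.
  move=> t0 t; pose t' i := if A i then g * c i * t0 else t i.
  apply: (@le_trans _ _ (\sum_i sabs (t' i) ^+ 2)).
    apply: le_trans (Ha t'); rewrite le_eqVlt; apply/orP; left; apply/eqP.
    apply: eq_bigr => j _; congr (sabs _ ^+ 2).
    rewrite /a0 mulr_sumr mulr_suml -big_split; apply: eq_bigr => i _ /=.
    rewrite /t' /a1; case: ifPn => Ai; first by rewrite mul0r addr0; ring.
    by rewrite cNA // mulr0 mulr0 mul0r add0r.
  have -> : sabs t0 ^+ 2 = \sum_i sabs (g * c i * t0) ^+ 2.
    rewrite (eq_bigr (fun i => S^-1 * sabs t0 ^+ 2 * sabs (c i) ^+ 2)).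
      by rewrite -mulr_sumr mulrAC mulVf ?mul1r // gt_eqF.
    by move=> i _; rewrite !sabsM !exprMn g2 mulrAC.
  rewrite -big_split; apply: ler_sum => i _ /=; rewrite /t'; case: ifP => _.
    by rewrite lerDl sqr_ge0.
  by rewrite lerDr sqr_ge0.
have -> : \sum_j rnorm (a0 j *: y0 + \sum_i a1 j i *: y1 i) ^+ 2 =
    S^-1 * \sum_j rnorm (\sum_i a j i *: y i) ^+ 2.
  rewrite mulr_sumr; apply: eq_bigr => j _; rewrite -g2 -exprMn -rnormZs.
  congr (rnorm _ ^+ 2); rewrite /a0 mulr_sumr scaler_suml scaler_sumr -big_split.
  apply: eq_bigr => i _ /=; rewrite /a1 /y1; case: ifPn => Ai.
    by have := Hc i; rewrite Ai => ->; rewrite scaler0 addr0 !scalerA mulrA.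
  by rewrite cNA // !mulr0 scale0r add0r !scalerA mulrC.
have q00 : q 0 = 0 by rewrite -(scale0r (0 : Y)) qZ sabs0 expr0n mul0r.
have -> : q y0 - d + \sum_i q (y1 i) = S^-1 * \sum_i p (y i).
  rewrite mulr_sumr; have -> : q y0 - d = \sum_i S^-1 * (sabs (c i) ^+ 2 * (q y0 - d)).
    by rewrite -mulr_sumr -mulr_suml mulrA mulVf ?mul1r // gt_eqF.
  rewrite -big_split; apply: eq_bigr => i _ /=; rewrite /y1; case: ifPn => Ai.
    by rewrite q00 addr0 (pA i Ai).
  by rewrite (cNA i Ai) sabs0 expr0n mul0r mulr0 add0r qZ g2 pNA.
by rewrite ltr_pM2l // invr_gt0.
Qed.

(** The parallelogram inequality: combine two almost tight instances for
    $v_1 + v_2$ and $v_1 - v_2$ into one for $\sqrt2 v_1$ and $\sqrt2 v_2$. *)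
Lemma minimal_parallelogram_le v1 v2 :
  q (v1 + v2) + q (v1 - v2) <= 2 * (q v1 + q v2).
Proof.
apply/ler_addgt0Pr => d d0; have [_ _ qZ qP] := Hq.
have d2 : 0 < d / 2 by rewrite divr_gt0.
have [I1 [J1 [b0 [b [y [Hb ltb]]]]]] := minimal_almost_tight (v1 + v2) d2.
have [I2 [J2 [c0 [c [z [Hc ltc]]]]]] := minimal_almost_tight (v1 - v2) d2.
pose h : K := of_real s (Num.sqrt 2)^-1; pose g : K := of_real s (Num.sqrt 2).
have hg : h * g = 1.
  by rewrite -of_realM mulVf ?of_real1 // gt_eqF // sqrtr_gt0.
have g2 : sabs g ^+ 2 = 2.
  by rewrite sabs_of_real ger0_norm ?sqrtr_ge0 // sqr_sqrtr.
have h2 : sabs h ^+ 2 = 2^-1.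
  by rewrite sabs_of_real ger0_norm ?invr_ge0 ?sqrtr_ge0 // exprVn sqr_sqrtr.
pose I : finType := (bool + (I1 + I2))%type; pose J : finType := (J1 + J2)%type.
pose a (j : J) (i : I) : K :=
  match j, i with
  | inl j, inl _ => b0 j * h
  | inl j, inr (inl i) => b j i
  | inl j, inr (inr i) => 0
  | inr j, inl true => c0 j * h
  | inr j, inl false => - (c0 j * h)
  | inr j, inr (inl i) => 0
  | inr j, inr (inr i) => c j i
  end.
pose x (i : I) : Y :=
  match i with
  | inl true => g *: v1
  | inl false => g *: v2
  | inr (inl i) => y i
  | inr (inr i) => z i
  end.
have Ha : l2_contraction a.
  move=> t; rewrite !big_sumType /= big_bool.
  have e1 j : \sum_i a (inl j) i * t i =
      b0 j * (h * (t (inl true) + t (inl false))) + \sum_i b j i * t (inr (inl i)).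
    rewrite !big_sumType /= big_bool; congr (_ + _).
      by rewrite mulrDr mulrDr !mulrA.
    by rewrite [X in _ + X]big1 ?addr0 // => i _; rewrite mul0r.
  have e2 j : \sum_i a (inr j) i * t i =
      c0 j * (h * (t (inl true) - t (inl false))) + \sum_i c j i * t (inr (inr i)).
    rewrite !big_sumType /= big_bool; congr (_ + _).
      by rewrite mulrBr mulrBr !mulrA mulNr.
    by rewrite [X in X + _]big1 ?add0r // => i _; rewrite mul0r.
  rewrite (eq_bigr _ (fun j _ => congr1 (fun w => sabs w ^+ 2) (e1 j))).
  rewrite [X in _ + X <= _](eq_bigr _ (fun j _ => congr1 (fun w => sabs w ^+ 2) (e2 j))).
  rewrite (le_trans (lerD (Hb _ _) (Hc _ _))) // !sabsM !exprMn h2 addrACA -mulrDr.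
  by rewrite sabs_parallelogram mulrA mulVf ?pnatr_eq0 // mul1r.
have := qP I J a x Ha; rewrite !big_sumType /= big_bool /= !qZ g2.
have e1 j : \sum_i a (inl j) i *: x i = b0 j *: (v1 + v2) + \sum_i b j i *: y i.
  rewrite !big_sumType /= big_bool /=; congr (_ + _).
    by rewrite !scalerA -mulrA hg mulr1 scalerDr.
  by rewrite [X in _ + X]big1 ?addr0 // => i _; rewrite scale0r.
have e2 j : \sum_i a (inr j) i *: x i = c0 j *: (v1 - v2) + \sum_i c j i *: z i.
  rewrite !big_sumType /= big_bool /=; congr (_ + _).
    by rewrite !scalerA mulNr -mulrA hg mulr1 scalerBr scaleNr.
  by rewrite [X in X + _]big1 ?add0r // => i _; rewrite scale0r.
rewrite (eq_bigr _ (fun j _ => congr1 (fun w => rnorm w ^+ 2) (e1 j))).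
rewrite [X in _ + X <= _](eq_bigr _ (fun j _ => congr1 (fun w => rnorm w ^+ 2) (e2 j))).
move: ltb ltc; lra.
Qed.

Lemma minimal_parallelogram v1 v2 :
  q (v1 + v2) + q (v1 - v2) = 2 * (q v1 + q v2).
Proof.
apply/eqP; rewrite eq_le minimal_parallelogram_le /=.
have [_ _ qZ _] := Hq.
have := minimal_parallelogram_le (v1 + v2) (v1 - v2).
have dbl v : q (v + v) = 4 * q v.
  have -> : v + v = of_real s 2 *: v.
    by rewrite -[in RHS](scale_half v) scalerA -of_realM mulfV ?pnatr_eq0 // of_real1 scale1r.
  by rewrite qZ sabs_of_real ger0_norm // -natrX.
have -> : v1 + v2 + (v1 - v2) = v1 + v1 by rewrite addrACA subrr addr0.
have -> : v1 + v2 - (v1 - v2) = v2 + v2.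
  by rewrite opprB (addrC v1 v2) addrACA subrr addr0.
rewrite !dbl; lra.
Qed.

End Minimal.

(** The space [Y] carries an equivalent quadratic norm. *)
Theorem equivalent_quadratic_form : exists q : Y -> R,
  [/\ forall y, rnorm y ^+ 2 <= q y, forall y, q y <= M * rnorm y ^+ 2,
      forall (c : K) y, q (c *: y) = sabs c ^+ 2 * q y &
      forall x y, q (x + y) + q (x - y) = 2 * (q x + q y)].
Proof.
have [q Hq q_min] := minimal_majorant.
exists q; case: (Hq) => q0 qM qZ qP; split => //.
  move=> y; have := qP 'I_1 'I_1 (fun _ _ => 1) (fun=> y).
  rewrite !big_ord1 scale1r; apply=> t.
  by rewrite !big_ord1 mul1r.
exact: minimal_parallelogram.
Qed.

End HilbertianNorm.

(** * The Jordan-von Neumann theorem *)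

Section Conjugation.
Variables (R : realType) (s : scalar_kind).
Local Notation K := (scalar_field R s).

Lemma scalar_conjD (a b : K) : scalar_conj (a + b) = scalar_conj a + scalar_conj b.
Proof. by move: a b; case: s => //= a b; rewrite rmorphD. Qed.

Lemma scalar_conjM (a b : K) : scalar_conj (a * b) = scalar_conj a * scalar_conj b.
Proof. by move: a b; case: s => //= a b; rewrite rmorphM. Qed.

Lemma scalar_conjN (a : K) : scalar_conj (- a) = - scalar_conj a.
Proof. by move: a; case: s => //= a; rewrite rmorphN. Qed.

Lemma scalar_conj_of_real (r : R) : scalar_conj (of_real s r) = of_real s r.
Proof. by case: s => //=; rewrite /real_complex_def /= oppr0. Qed.

Lemma scalar_conj_iunit : scalar_conj (iunit R s) = - iunit R s.
Proof.
rewrite /iunit; case: s => /=; first by rewrite oppr0.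
by rewrite /GRing.opp /= oppr0.
Qed.

Lemma iunit_cases : iunit R s = 0 \/ (iunit R s * iunit R s = -1 /\ sabs (iunit R s) = 1).
Proof.
have H : iunit R s = 0 \/ iunit R s * iunit R s = -1.
  rewrite /iunit; case: s => /=; first by left.
  by right; rewrite -expr2 sqr_i.
case: H => [|e]; [by left | right; split => //].
have := congr1 (@sabs R s) e; rewrite sabsM sabsN sabs1 -expr2 => /eqP.
by rewrite sqrf_eq1 => /orP[/eqP //|/eqP h]; have := sabs_ge0 (iunit R s); rewrite h ler0N1.
Qed.

End Conjugation.

Section JordanVonNeumann.
Variables (R : realType) (s : scalar_kind).
Local Notation K := (scalar_field R s).
Variables (Y : normedModType K) (q : Y -> R).
Hypothesis q_ge0 : forall y, 0 <= q y.
Hypothesis qZ : forall (c : K) y, q (c *: y) = sabs c ^+ 2 * q y.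
Hypothesis q_par : forall x y, q (x + y) + q (x - y) = 2 * (q x + q y).

Lemma quad0 : q 0 = 0.
Proof. by rewrite -(scale0r (0 : Y)) qZ sabs0 expr0n mul0r. Qed.

Lemma quadN y : q (- y) = q y.
Proof. by rewrite -scaleN1r qZ sabsN sabs1 expr1n mul1r. Qed.

Lemma quad_double y : q (y + y) = 4 * q y.
Proof. by have := q_par y y; rewrite subrr quad0; lra. Qed.

(** The polar form. *)
Definition polar (x y : Y) : R := (q (x + y) - q (x - y)) / 4.

Lemma polarC x y : polar x y = polar y x.
Proof. by rewrite /polar (addrC x y) -[q (x - y)]quadN opprB. Qed.

Lemma polarE x : polar x x = q x.
Proof. by rewrite /polar subrr quad0 quad_double subr0 mulrC mulKf // pnatr_eq0. Qed.

Lemma polar0l y : polar 0 y = 0.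
Proof. by rewrite /polar add0r sub0r quadN subrr mul0r. Qed.

Lemma polarNl x y : polar (- x) y = - polar x y.
Proof.
rewrite /polar -[q (- x + y)]quadN opprD opprK -[q (- x - y)]quadN opprD !opprK.
by rewrite -mulNr opprB.
Qed.

Lemma polar_sum_diff x z y : polar (x + z) y + polar (x - z) y = 2 * polar x y.
Proof.
have h1 := q_par (x + y) z; have h2 := q_par (x - y) z.
rewrite /polar (addrAC x z y) (addrAC x z (- y)) (addrAC x (- z) y) (addrAC x (- z) (- y)).
by move: h1 h2; lra.
Qed.

Lemma polarDl x z y : polar (x + z) y = polar x y + polar z y.
Proof.
have dbl v : polar (v + v) y = 2 * polar v y.
  by rewrite -(polar_sum_diff v v y) subrr polar0l addr0.
pose h v : Y := of_real s (2^-1 : R) *: v.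
have := polar_sum_diff (h (x + z)) (h (x - z)) y; rewrite -dbl.
have -> : h (x + z) + h (x - z) = x.
  by rewrite /h -scalerDr addrACA subrr addr0 scale_half.
have -> : h (x + z) - h (x - z) = z.
  by rewrite /h -scalerBr opprB (addrC x z) addrACA subrr addr0 scale_half.
by rewrite /h -scalerDr scale_half.
Qed.

Lemma polar_bound x y : `|polar x y| <= (q x + q y) / 2.
Proof.
have := q_par x y; have := q_ge0 (x + y); have := q_ge0 (x - y).
by rewrite /polar ler_norml; lra.
Qed.

(** An additive function that is bounded on $[0, 1]$ and vanishes at $1$ is
    zero. *)
Lemma additive_bounded_eq0 (g : R -> R) (c : R) :
  (forall t u, g (t + u) = g t + g u) -> g 1 = 0 ->
  (forall t, 0 <= t <= 1 -> `|g t| <= c) -> forall t, g t = 0.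
Proof.
move=> gD g1 gc.
have g0 : g 0 = 0 by have := gD 0 0; rewrite addr0; lra.
have gN t : g (- t) = - g t by have := gD t (- t); rewrite subrr g0; lra.
have gn n t : g (n%:R * t) = n%:R * g t.
  elim: n => [|n IH]; first by rewrite !mul0r g0.
  by rewrite -natr1 !mulrDl !mul1r gD IH.
have gnat n : g n%:R = 0 by rewrite -[n%:R]mulr1 gn g1 mulr0.
have pos t : 0 <= t -> g t = 0.
  move=> t0; apply/eqP; rewrite -normr_le0; apply/ler_addgt0Pr => e e0; rewrite add0r.
  have [N /(_ N (leqnn N)) HN] := inv_nat_small c e0; rewrite (le_trans _ HN) //.
  rewrite ler_pdivlMr // mulrC -[X in X * _]ger0_norm // -normrM -gn.
  set u := N.+1%:R * t; have u0 : 0 <= u by rewrite mulr_ge0.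
  have -> : g u = g (u - (Num.truncn u)%:R).
    by rewrite gD gN gnat subr0.
  have /andP[h1 h2] := truncn_itv u0; apply: gc.
  by rewrite subr_ge0 h1 lerBlDr addrC natr1 ltW.
move=> t; have [/pos //|t0] := leP 0 t.
by rewrite -[t]opprK gN pos ?oppr0 // oppr_ge0 ltW.
Qed.

(** The map $t \mapsto B(tx, y) - t B(x, y)$, with $B$ the polar form, is additive
    and bounded on $[0, 1]$. *)
Lemma polarZl (t : R) x y : polar (of_real s t *: x) y = t * polar x y.
Proof.
apply/eqP; rewrite -subr_eq0; apply/eqP.
pose g u := polar (of_real s u *: x) y - u * polar x y.
apply: (@additive_bounded_eq0 g ((q x + q y) / 2 + `|polar x y|)).
- by move=> u v; rewrite /g of_realD scalerDl polarDl mulrDl opprD addrACA.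
- by rewrite /g of_real1 scale1r mul1r subrr.
move=> u /andP[u0 u1]; rewrite /g (le_trans (ler_normB _ _)) // lerD //.
  rewrite (le_trans (polar_bound _ _)) // ler_pM2r ?invr_gt0 // lerD2r.
  by rewrite qZ sabs_of_real ler_piMl // ger0_norm // expr_le1.
by rewrite normrM ger0_norm // ler_piMl.
Qed.

Lemma polarZr (t : R) x y : polar x (of_real s t *: y) = t * polar x y.
Proof. by rewrite polarC polarZl polarC. Qed.

Lemma quadD x y : q (x + y) = q x + 2 * polar x y + q y.
Proof. by rewrite /polar; have := q_par x y; lra. Qed.

Lemma polar_cauchy_schwarz x y : polar x y <= Num.sqrt (q x) * Num.sqrt (q y).
Proof.
set a := Num.sqrt (q x); set b := Num.sqrt (q y).
have a2 : a ^+ 2 = q x by rewrite sqr_sqrtr.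
have b2 : b ^+ 2 = q y by rewrite sqr_sqrtr.
have a0 : 0 <= a by exact: sqrtr_ge0.
have b0 : 0 <= b by exact: sqrtr_ge0.
apply/ler_addgt0Pr => e e0.
(* [q] is nonnegative at $(b + d) x - (a + d) y$; the shift by $d > 0$ avoids a
   separate treatment of isotropic vectors *)
have key (d : R) : 0 < d -> (a + d) * (b + d) * polar x y <= ((a + d) * (b + d)) ^+ 2.
  move=> d0; have := q_ge0 (of_real s (b + d) *: x - of_real s (a + d) *: y).
  rewrite -scaleNr -of_realN quadD polarZl polarZr !qZ !sabs_of_real.
  rewrite normrN !real_normK ?num_real // -a2 -b2.
  have h1 : (b + d) ^+ 2 * a ^+ 2 <= ((a + d) * (b + d)) ^+ 2.
    rewrite exprMn mulrC ler_wpM2r ?sqr_ge0 // ler_pXn2r ?nnegrE ?addr_ge0 ?(ltW d0) //.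
    by rewrite lerDl ltW.
  have h2 : (a + d) ^+ 2 * b ^+ 2 <= ((a + d) * (b + d)) ^+ 2.
    rewrite exprMn ler_wpM2l ?sqr_ge0 // ler_pXn2r ?nnegrE ?addr_ge0 ?(ltW d0) //.
    by rewrite lerDl ltW.
  by move: h1 h2; lra.
have {}key (d : R) : 0 < d -> polar x y <= (a + d) * (b + d).
  move=> d0; have p0 : 0 < (a + d) * (b + d) by rewrite mulr_gt0 // ltr_wpDl.
  by have := key d d0; rewrite expr2 ler_pM2l.
pose d := Num.min 1 (e / (a + b + 1)).
have ab0 : 0 < a + b + 1 by rewrite ltr_wpDl // addr_ge0.
have d0 : 0 < d by rewrite lt_min ltr01 divr_gt0.
rewrite (le_trans (key d d0)) // (_ : (a + d) * (b + d) = a * b + d * (a + b + d)); last by ring.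
rewrite lerD2l (@le_trans _ _ (d * (a + b + 1))) //.
  by rewrite ler_wpM2l ?(ltW d0) // lerD2l /d ge_min lexx.
by rewrite -ler_pdivlMr // /d ge_min lexx orbT.
Qed.

Lemma sqrt_quadD x y : Num.sqrt (q (x + y)) <= Num.sqrt (q x) + Num.sqrt (q y).
Proof.
rewrite -(ler_pXn2r (n := 2)) ?nnegrE ?addr_ge0 ?sqrtr_ge0 //.
rewrite sqrrD !sqr_sqrtr // quadD lerD2r lerD2l.
by rewrite -[leRHS]mulr_natl ler_pM2l // polar_cauchy_schwarz.
Qed.

Lemma sqrt_quadZ (c : K) y : Num.sqrt (q (c *: y)) = sabs c * Num.sqrt (q y).
Proof.
by rewrite qZ sqrtrM ?sqr_ge0 // sqrtr_sqr ger0_norm // sabs_ge0.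
Qed.

(** The inner product: the polar form over the reals, and its sesquilinear
    extension over the complex numbers. *)
Definition inner (x y : Y) : K :=
  of_real s (polar x y) + iunit R s * of_real s (polar x (iunit R s *: y)).

(** Multiplication by the imaginary unit preserves [q], so that it is
    skew-adjoint for the polar form. *)
Lemma polar_iunit x y : polar (iunit R s *: x) y = - polar x (iunit R s *: y).
Proof.
have [->|[i2 ni]] := iunit_cases R s.
  by rewrite !scale0r polar0l polarC polar0l oppr0.
have inv a b : polar (iunit R s *: a) (iunit R s *: b) = polar a b.
  by rewrite /polar -scalerDr -scalerBr !qZ ni expr1n !mul1r.
by rewrite -inv scalerA i2 scaleN1r polarNl.
Qed.

Lemma innerDl x z y : inner (x + z) y = inner x y + inner z y.
Proof. by rewrite /inner !polarDl !of_realD mulrDr addrACA. Qed.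

Lemma innerZl (c : K) x y : inner (c *: x) y = c * inner x y.
Proof.
have real (r : R) z : inner (of_real s r *: z) y = of_real s r * inner z y.
  by rewrite /inner !polarZl !of_realM mulrDr; congr (_ + _); rewrite mulrCA.
have imag z : inner (iunit R s *: z) y = iunit R s * inner z y.
  rewrite /inner !polar_iunit; have [->|[i2 _]] := iunit_cases R s.
    by rewrite !mul0r addr0 scale0r polarC polar0l oppr0 of_real0.
  rewrite scalerA i2 scaleN1r [polar z (- y)]polarC polarNl (polarC y) opprK.
  by rewrite mulrDr mulrA i2 mulN1r of_realN addrC.
have [u [v [-> _]]] := scalar_decomp c.
by rewrite scalerDl innerDl -scalerA imag !real mulrDl mulrA.
Qed.

Lemma inner_conj x y : inner x y = scalar_conj (inner y x).
Proof.
rewrite /inner scalar_conjD scalar_conjM !scalar_conj_of_real scalar_conj_iunit.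
by rewrite (polarC y x) (polarC y (_ *: _)) polar_iunit of_realN mulrNN.
Qed.

Lemma inner_self x : inner x x = of_real s (q x).
Proof.
have h : polar x (iunit R s *: x) = 0.
  by have := polar_iunit x x; rewrite polarC; lra.
by rewrite /inner h polarE of_real0 mulr0 addr0.
Qed.

End JordanVonNeumann.

(** * Renorming by an equivalent quadratic form *)

(** A quadratic form equivalent to the square of the norm. *)
Record quadratic_norm (R : realType) (s : scalar_kind)
    (Y : completeNormedModType (scalar_field R s)) := QuadraticNorm {
  quad :> Y -> R;
  quad_const : R;
  quad_const_ge0 : 0 <= quad_const;
  quad_ge : forall y, rnorm y ^+ 2 <= quad y;
  quad_le : forall y, quad y <= quad_const * rnorm y ^+ 2;
  quadZ : forall (c : scalar_field R s) y, quad (c *: y) = sabs c ^+ 2 * quad y;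
  quad_parallelogram : forall x y, quad (x + y) + quad (x - y) = 2 * (quad x + quad y)
}.

Section Renormed.
Variables (R : realType) (s : scalar_kind).
Local Notation K := (scalar_field R s).
Variables (Y : completeNormedModType K) (q : quadratic_norm Y).

(** The space [Y] with the norm $\sqrt q$. *)
Definition renormed : Type := Y.

HB.instance Definition _ := GRing.Lmodule.copy renormed Y.

Lemma quad_ge0 y : 0 <= q y.
Proof. by rewrite (le_trans _ (quad_ge q y)) // sqr_ge0. Qed.

Definition renorm (y : renormed) : K := of_real s (Num.sqrt (q y)).

Lemma renormD (x y : renormed) : renorm (x + y) <= renorm x + renorm y.
Proof.
rewrite /renorm -of_realD ler_of_real.
exact: (sqrt_quadD quad_ge0 (quadZ q) (quad_parallelogram q)).
Qed.

Lemma renormZ (c : K) (y : renormed) : renorm (c *: y) = `|c| * renorm y.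
Proof.
rewrite /renorm -sabsE -of_realM; congr of_real.
exact: (sqrt_quadZ (quadZ q)).
Qed.

Lemma renorm0_eq0 (y : renormed) : renorm y = 0 -> y = 0.
Proof.
rewrite -(of_real0 R s) => /of_real_inj /eqP; rewrite sqrtr_eq0 => h.
apply: (@rnorm0_eq0 R s Y); apply/eqP; rewrite -sqrf_eq0.
by rewrite eq_le sqr_ge0 andbT (le_trans (quad_ge q y)).
Qed.

HB.instance Definition _ :=
  Lmodule_isNormed.Build K renormed renormD renormZ renorm0_eq0.

Lemma rnorm_renormed (y : renormed) : rnorm y = Num.sqrt (q y).
Proof. exact: of_realK. Qed.

Lemma rnorm_le_renormed (y : renormed) : rnorm (y : Y) <= rnorm y.
Proof.
rewrite rnorm_renormed -(ger0_norm (rnorm_ge0 (y : Y))) -sqrtr_sqr.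
apply: ler_wsqrtr; exact: (quad_ge q y).
Qed.

Lemma renormed_le_rnorm (y : renormed) :
  rnorm y <= Num.sqrt (quad_const q) * rnorm (y : Y).
Proof.
rewrite rnorm_renormed -{1}(ger0_norm (rnorm_ge0 (y : Y))) -sqrtr_sqr -sqrtrM ?quad_const_ge0 //.
apply: ler_wsqrtr; exact: (quad_le q y).
Qed.

Lemma renormed_cauchy_cvg (F : set_system renormed) :
  ProperFilter F -> cauchy F -> cvg F.
Proof.
move=> FF cF.
have : cauchy (F : set_system Y).
  apply/cauchy_ballP => _ /pos_of_real[r r0 ->].
  have r0' : 0 < of_real s r by rewrite -(of_real0 R s) ltr_of_real.
  have /cauchy_ballP/(_ (of_real s r) r0') := cF.
  apply: filterS => -[x y] /=; rewrite -!ball_normE /ball_ /= !rnorm_lt.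
  exact/le_lt_trans/rnorm_le_renormed.
move=> /cauchy_cvg /cvg_ex[/= l Fl].
apply/cvg_ex; exists (l : renormed).
apply/(@cvgrPdist_lt K renormed _ F _ id) => _ /pos_of_real[r r0 ->].
have c0 : 0 < Num.sqrt (quad_const q) + 1 by rewrite ltr_wpDl // sqrtr_ge0.
have d0 : 0 < of_real s (r / (Num.sqrt (quad_const q) + 1)).
  by rewrite -(of_real0 R s) ltr_of_real divr_gt0.
have /(@cvgrPdist_lt K Y _ F _ id)/(_ _ d0) := Fl.
apply: filterS => x /=; rewrite !rnorm_lt ltr_pdivlMr // => h.
rewrite (le_lt_trans (renormed_le_rnorm _)) // (le_lt_trans _ h) // mulrC.
by rewrite ler_wpM2l ?rnorm_ge0 // lerDl.
Qed.

HB.instance Definition _ := Uniform_isComplete.Build renormed renormed_cauchy_cvg.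

Definition renormed_complete : completeNormedModType K := renormed.

Definition renormed_inner : renormed -> renormed -> K := inner q.

Lemma renormed_inner_zmodl (y : renormed) : zmod_morphism (renormed_inner ^~ y).
Proof.
move=> x z; rewrite /renormed_inner -scaleN1r.
have -> := @innerDl R s Y q (quadZ q) (quad_parallelogram q) x (-1 *: z) y.
have -> := @innerZl R s Y q quad_ge0 (quadZ q) (quad_parallelogram q) (-1) z y.
by rewrite mulN1r.
Qed.

Lemma renormed_inner_conj (x y : renormed) :
  renormed_inner x y = scalar_conj (renormed_inner y x).
Proof. exact: (@inner_conj R s Y q (quadZ q) x y). Qed.

Lemma renormed_inner_hermitian (x y : renormed) :
  renormed_inner x y = (-1) ^+ false * scalar_conj (renormed_inner y x).
Proof. by rewrite expr0 mul1r renormed_inner_conj. Qed.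

Lemma renormed_inner_zmodr (x : renormed) : zmod_morphism (renormed_inner x).
Proof.
move=> y z; rewrite !(renormed_inner_conj x) renormed_inner_zmodl.
by rewrite scalar_conjD scalar_conjN.
Qed.

Lemma renormed_inner_linearl (y : renormed) :
  scalable_for *%R (renormed_inner ^~ y).
Proof.
move=> c x.
exact: (@innerZl R s Y q quad_ge0 (quadZ q) (quad_parallelogram q)).
Qed.

Lemma renormed_inner_linearr (x : renormed) :
  scalable_for (@scalar_conj R s \; *%R) (renormed_inner x).
Proof.
move=> c y; rewrite !(renormed_inner_conj x) renormed_inner_linearl.
by rewrite scalar_conjM.
Qed.

Lemma renormed_inner_self (x : renormed) : renormed_inner x x = `|x| ^+ 2.
Proof.
rewrite /renormed_inner (@inner_self R s Y q (quadZ q) (quad_parallelogram q)).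
rewrite -to_realK rnorm_renormed expr2 -of_realM -expr2 sqr_sqrtr //.
exact: quad_ge0.
Qed.

Lemma renormed_inner_gt0 (x : renormed) : x != 0 -> 0 < renormed_inner x x.
Proof. by move=> x0; rewrite renormed_inner_self exprn_gt0 // normr_gt0. Qed.

HB.instance Definition _ := isBilinear.Build K renormed renormed K
  *%R (@scalar_conj R s \; *%R) renormed_inner
  renormed_inner_zmodl renormed_inner_zmodr
  renormed_inner_linearl renormed_inner_linearr.
HB.instance Definition _ := isHermitianSesquilinear.Build K renormed
  false (@scalar_conj R s) renormed_inner renormed_inner_hermitian.
HB.instance Definition _ := isDotProduct.Build K renormed
  renormed_inner renormed_inner_gt0.

Lemma renormed_is_hilbert : is_hilbert renormed_complete.
Proof. by exists renormed_inner; exact: renormed_inner_self. Qed.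

Lemma renormed_isomorphic : isomorphic Y renormed_complete.
Proof.
have lin : linear (id : Y -> renormed) by [].
have lin' : linear (id : renormed -> Y) by [].
exists (HB.pack_for {linear Y -> renormed} (id : Y -> renormed)
    (GRing.isLinear.Build K Y renormed *:%R _ lin)).
exists (HB.pack_for {linear renormed -> Y} (id : renormed -> Y)
    (GRing.isLinear.Build K renormed Y *:%R _ lin')).
split=> //.
  apply: (@bounded_operator_continuous R s Y renormed id (Num.sqrt (quad_const q))).
  by split => // y; exact: renormed_le_rnorm.
apply: (@bounded_operator_continuous R s renormed Y id 1).
by split => // y; rewrite mul1r; exact: rnorm_le_renormed.
Qed.

End Renormed.

(** * The theorem *)

Theorem theorem5p8 (R : realType) (s : scalar_kind) (m : nat) (hm : (0 < m)%N)
    (X Y : completeNormedModType (scalar_field R s))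
    (hX : infinite_dimensional X) (hY : infinite_dimensional Y)
    (hbasis : exists e : nat -> X, unconditional_basis e)
    (hFSt : @factorable_strongly_summing R s m 1 X Y =
            @continuous_multilinear R s m X Y) :
  isomorphic X (l1 R s) /\
  exists H : completeNormedModType (scalar_field R s),
    is_hilbert H /\ isomorphic Y H.
Proof.
have [e He] := hbasis; have [Cu Cu0 HCu] := unconditional_constant He.
pose psi x : (scalar_field R s)^o := bcoef He x 0%N.
have Hpsi : bounded_linear psi (Cu / rnorm (e 0%N)).
  split=> [c x y|x]; first exact: bcoefZD.
  have e0 := rnorm_gt0 (basis_neq0 He 0%N).
  rewrite mulrAC ler_pdivlMr //; exact: le_trans (unorm_bcoef He x 0%N) (HCu x).
have psi1 : psi (e 0%N) = 1 by rewrite /psi bcoef_basis eqxx.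
have all_summing (u : X -> Y) B : bounded_linear u B -> exists C, summing u C.
  exact: (factorable_linear_summing hm Hpsi psi1 hFSt).
have [k k0 Hk] := uniform_summing all_summing.
have HC := l1sum_bounded hY Cu0 HCu k0 Hk.
set C := _ ^+ 2 in HC; have C0 : 0 <= C by exact: sqr_ge0.
split; first exact: isomorphic_l1 HC.
have HM := l2_contraction_inequality C0 HC k0 Hk.
have [q [q1 q2 q3 q4]] := equivalent_quadratic_form (sqr_ge0 _) HM.
pose Q := QuadraticNorm (sqr_ge0 (k * C)) q1 q2 q3 q4.
exists (renormed_complete Q); split; first exact: renormed_is_hilbert.
exact: renormed_isomorphic.
Qed.
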